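(* Let $\Lambda$ be an ordinal graph and $\alpha\in\mathrm{Ord}$. Let $\{T_e:e\in\Lambda_{\alpha+1}\}$ be the generators of $\mathcal{O}(\Lambda_{\alpha+1})$ and let $\mathcal{A}_{\alpha}=\rho_{\alpha}^{\alpha+1}(\mathcal{O}(\Lambda_{\alpha}))\subseteq\mathcal{O}(\Lambda_{\alpha+1})$. Define $$X_{\alpha}=\overline{\mathrm{span}}\left\{T_eT_f^{*}\in\mathcal{O}(\Lambda_{\alpha+1}):\omega^{\alpha}\leq d(e)<\omega^{\alpha}\cdot 2,\ f\in\Lambda_{\alpha}\right\}.$$ For $x,y\in X_\alpha$ and $a\in\mathcal{A}_\alpha$ define $x\cdot a=xa\in X_\alpha$, $\varphi_\alpha(a)x=a\cdot x=ax\in X_\alpha$, and $\langle x,y\rangle_\alpha=x^{*}y\in\mathcal{A}_\alpha$, where $\varphi_\alpha:\mathcal{A}_\alpha\to\mathcal{L}(X_\alpha)$. Then $(X_\alpha,\varphi_\alpha)$ is a $\mathrm{C}^*$-correspondence over $\mathcal{A}_\alpha$ (in particular, these operations take values in the indicated spaces).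
   Context: $\mathrm{Ord}$ is the class of ordinals, a monoid under ordinal addition. An ordinal graph is a pair $(\Lambda,d)$, where $\Lambda$ is a small category (identified with its set of morphisms, called paths) and $d:\Lambda\to\mathrm{Ord}$ is a functor (so $d(ef)=d(e)+d(f)$) such that for every $e\in\Lambda$ and every ordinal $\alpha\le d(e)$ there exist unique $f,g\in\Lambda$ with $d(f)=\alpha$ and $e=fg$. The maps $s,r$ are source and range; $ef$ is defined iff $s(e)=r(f)$. Put $e\Lambda=\{ef:f\in\Lambda,\ r(f)=s(e)\}$; for a vertex $v$ this is $v\Lambda=\{e:r(e)=v\}$. $\Lambda_\alpha=\{e\in\Lambda:d(e)<\omega^\alpha\}$ (an ordinal graph with the restricted $d$), and $\Lambda_0$ is the set of vertices (paths of length $0$, i.e. identity morphisms). $F\subseteq v\Lambda$ is exhaustive for $v\in\Lambda_0$ if for all $f\in v\Lambda$ there is $e\in F$ with $e\Lambda\cap f\Lambda\neq\emptyset$. For an ordinal graph $\Lambda$, $\mathcal O(\Lambda)$ is the universal $\mathrm C^*$-algebra generated by $\{T_e:e\in\Lambda\}$ subject to: (1) $T_e^*T_e=T_{s(e)}$; (2) $T_eT_f=T_{ef}$ if $s(e)=r(f)$; (3) $T_eT_e^*T_fT_f^*$ equals $T_eT_e^*$ if $e\in f\Lambda$, $T_fT_f^*$ if $f\in e\Lambda$, and $0$ otherwise; (4) $T_v=\bigvee_{e\in F}T_eT_e^*$ (join of projections) if $F$ is finite and exhaustive for $v$. For $\alpha\le\beta$ there is a $*$-homomorphism $\rho_\alpha^\beta:\mathcal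 O(\Lambda_\alpha)\to\mathcal O(\Lambda_\beta)$ sending the generator of $e\in\Lambda_\alpha$ to the generator of $e$ in $\mathcal O(\Lambda_\beta)$. A $\mathrm C^*$-correspondence over a $\mathrm C^*$-algebra $A$ is a pair $(X,\phi)$ with $X$ a right Hilbert $A$-module and $\phi:A\to\mathcal L(X)$ a $*$-homomorphism into the adjointable operators. *)

(* Defs.v *)
From HB Require Import structures.
From mathcomp Require Import all_boot all_order all_algebra.
From mathcomp Require Import all_classical all_reals all_analysis.
From mathcomp Require Import complex.

Set Implicit Arguments.
Unset Strict Implicit.
Unset Printing Implicit Defensive.

Import Order.TTheory GRing.Theory Num.Theory.
Import numFieldNormedType.Exports.

(* [Sup f] denotes the least ordinal strictly above all the ordinals denoted by
   the [f i]; every ordinal is denoted by some tree, but not by a unique one.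
   Ordinals are the trees modulo [tree_eq]. *)
Inductive tree : Type := Sup (U : Type) (f : U -> tree).

Fixpoint tree_le (x y : tree) : Prop :=
  let: Sup U f := x in
  forall i : U, let: Sup J g := y in exists j : J, tree_le (f i) (g j).

Definition tree_lt (x y : tree) : Prop :=
  let: Sup J g := y in exists j : J, tree_le x (g j).

Definition tree0 : tree := @Sup False (False_rect _).

Definition treeS (x : tree) : tree := @Sup unit (fun=> x).

(* x + y is the least ordinal above all z < x and all x + z with z < y *)
Fixpoint tree_add (x y : tree) : tree :=
  let: Sup U f := x in
  let: Sup J g := y in
  @Sup (U + J) (fun k => match k with
                         | inl i => f i
                         | inr j => tree_add x (g j)
                         end).

Definition tree_muln (x : tree) (n : nat) : tree :=
  iter n (tree_add^~ x) tree0.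

(* omega^x is the least ordinal above 0 and all omega^z * n with z < x *)
Fixpoint tree_wpow (x : tree) : tree :=
  let: Sup U f := x in
  @Sup (option (U * nat)) (fun k => match k with
                                    | None => tree0
                                    | Some (i, n) => tree_muln (tree_wpow (f i)) n
                                    end).

Lemma tree_le_refl x : tree_le x x.
Proof. by elim: x => U f IH /= i; exists i. Qed.

Lemma tree_le_trans y x z : tree_le x y -> tree_le y z -> tree_le x z.
Proof.
elim: x y z => U f IH [J g] [K h] /= xy yz i.
have [j ij] := xy i; have [k jk] := yz j.
by exists k; apply: IH ij jk.
Qed.

Lemma tree_le_Sup U (f : U -> tree) y :
  tree_le (Sup f) y <-> forall i, tree_lt (f i) y.
Proof. by case: y. Qed.

Lemma tree_ltW x y : tree_lt x y -> tree_le x y.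
Proof.
elim: x y => U f IH [J g] [j /tree_le_Sup xj]; apply/tree_le_Sup => i.
by exists j; apply: IH.
Qed.

Lemma tree_le_total x y : tree_le x y \/ tree_lt y x.
Proof.
elim: x y => U f IH y.
have [le|/existsNP[i ni]] := pselect (forall i, tree_lt (f i) y).
  by left; apply/tree_le_Sup.
right; exists i; case: y ni => J g ni; apply/tree_le_Sup => j.
by have [le|] := IH i (g j); first by case: ni; exists j.
Qed.

Lemma tree_lt_irr x : ~ tree_lt x x.
Proof. by elim: x => U f IH [i /tree_le_Sup /(_ i)]; apply: IH. Qed.

Lemma tree_le_lt_trans y x z : tree_le x y -> tree_lt y z -> tree_lt x z.
Proof. by case: z => K h xy /= [k yk]; exists k; apply: tree_le_trans yk. Qed.

Lemma tree_lt_le_trans y x z : tree_lt x y -> tree_le y z -> tree_lt x z.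
Proof.
case: y z => [J g] [K h] /= [j xj] yz; have [k jk] := yz j.
by exists k; apply: tree_le_trans jk.
Qed.

Lemma tree_le0 x : tree_le tree0 x. Proof. by []. Qed.

Lemma tree_add_le2l x y z : tree_le y z -> tree_le (tree_add x y) (tree_add x z).
Proof.
case: x => U f; elim: y z => J g IH [K h] /= yz [i|j].
  by exists (inl i); apply: tree_le_refl.
by have [k jk] := yz j; exists (inr k); apply: IH.
Qed.

Lemma tree_add_le2r x x' y : tree_le x x' -> tree_le (tree_add x y) (tree_add x' y).
Proof.
case: x x' => [U f] [U' f'] xx'; elim: y => J g IH /= [i|j].
  by have [i' ii'] := xx' i; exists (inl i').
by exists (inr j); apply: IH.
Qed.

Lemma tree_add_le x x' y y' : tree_le x x' -> tree_le y y' ->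
  tree_le (tree_add x y) (tree_add x' y').
Proof.
by move=> xx' yy'; apply: tree_le_trans (tree_add_le2r _ xx') (tree_add_le2l _ yy').
Qed.

Lemma tree_le_addr x y : tree_le x (tree_add x y).
Proof. by case: x y => [U f] [J g] i; exists (inl i); apply: tree_le_refl. Qed.

Lemma tree_le_addl x y : tree_le y (tree_add x y).
Proof.
case: x => U f; elim: y => J g IH /= j.
by exists (inr j); apply: IH.
Qed.

Lemma tree_addA x y z :
  tree_le (tree_add x (tree_add y z)) (tree_add (tree_add x y) z) /\
  tree_le (tree_add (tree_add x y) z) (tree_add x (tree_add y z)).
Proof.
case: x y => [U f] [J g]; elim: z => K h IH; split => /=.
- move=> [i|[j|k]]; first by exists (inl (inl i)); apply: tree_le_refl.
    by exists (inl (inr j)); apply: tree_le_refl.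
  by exists (inr k); apply: (IH k).1.
- move=> [[i|j]|k]; first by exists (inl i); apply: tree_le_refl.
    by exists (inr (inl j)); apply: tree_le_refl.
  by exists (inr (inr k)); apply: (IH k).2.
Qed.

Lemma tree_addt0 x : tree_le (tree_add x tree0) x.
Proof. by case: x => U f /= [i|//]; exists i; apply: tree_le_refl. Qed.

Lemma tree_add0t x : tree_le (tree_add tree0 x) x.
Proof. by elim: x => U f IH /= [//|i]; exists i; apply: IH. Qed.

Lemma tree_muln_le x x' m n : tree_le x x' -> (m <= n)%N ->
  tree_le (tree_muln x m) (tree_muln x' n).
Proof.
move=> xx'; elim: n m => [|n IH] [|m] //= mn.
by apply: tree_add_le => //; apply: IH.
Qed.

Lemma tree_mulnD x m n :
  tree_le (tree_add (tree_muln x m) (tree_muln x n)) (tree_muln x (m + n)).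
Proof.
elim: n => [|n IH]; first by rewrite addn0; apply: tree_addt0.
rewrite addnS /=; apply: tree_le_trans (tree_addA _ _ _).1 _.
exact: tree_add_le2r.
Qed.

Lemma tree_wpow_gt0 x : tree_lt tree0 (tree_wpow x).
Proof. by case: x => U f; exists None. Qed.

Lemma tree_wpow_le x x' : tree_le x x' -> tree_le (tree_wpow x) (tree_wpow x').
Proof.
elim: x x' => U f IH [U' f'] xx' /= [[i n]|]; last by exists None.
have [i' ii'] := xx' i; exists (Some (i', n)).
by apply: tree_muln_le => //; apply: IH.
Qed.

Lemma tree_wpow_add_lt x y z : tree_lt y (tree_wpow x) -> tree_lt z (tree_wpow x) ->
  tree_lt (tree_add y z) (tree_wpow x).
Proof.
case: x => U f [[[i m]|] yle] [[[j n]|] zle].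
- have [k [ik jk]] : exists k, tree_le (f i) (f k) /\ tree_le (f j) (f k).
    have [ij|/tree_ltW ji] := tree_le_total (f i) (f j).
      by exists j; split => //; apply: tree_le_refl.
    by exists i; split => //; apply: tree_le_refl.
  exists (Some (k, (m + n)%N)); apply: tree_le_trans (tree_mulnD _ _ _).
  apply: tree_add_le.
    by apply: tree_le_trans yle _; apply: tree_muln_le => //; apply: tree_wpow_le.
  by apply: tree_le_trans zle _; apply: tree_muln_le => //; apply: tree_wpow_le.
- exists (Some (i, m)); apply: tree_le_trans yle.
  by apply: tree_le_trans (tree_add_le2l _ zle) (tree_addt0 _).
- exists (Some (j, n)); apply: tree_le_trans zle.
  by apply: tree_le_trans (tree_add_le2r _ yle) (tree_add0t _).
- exists None; apply: tree_le_trans (tree_add_le2l _ zle) _.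
  exact: tree_le_trans (tree_addt0 _) yle.
Qed.

HB.instance Definition _ := gen_eqMixin tree.
HB.instance Definition _ := gen_choiceMixin tree.

Definition tree_eq (x y : tree) : bool := `[< tree_le x y /\ tree_le y x >].

Lemma tree_eq_refl : reflexive tree_eq.
Proof. by move=> x; apply/asboolP; split; apply: tree_le_refl. Qed.

Lemma tree_eq_sym : symmetric tree_eq.
Proof. by move=> x y; apply/asboolP/asboolP => -[]. Qed.

Lemma tree_eq_trans : transitive tree_eq.
Proof.
move=> y x z /asboolP[xy yx] /asboolP[yz zy]; apply/asboolP.
by split; [apply: tree_le_trans yz|apply: tree_le_trans yx].
Qed.

Canonical tree_equiv := EquivRel tree_eq tree_eq_refl tree_eq_sym tree_eq_trans.

Local Open Scope quotient_scope.

Definition Ord := {eq_quot tree_eq}.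
HB.instance Definition _ := Choice.on Ord.
HB.instance Definition _ : EqQuotient tree tree_eq Ord := EqQuotient.on Ord.

Lemma tree_reprK (x : tree) :
  tree_le (repr (\pi_Ord x)) x /\ tree_le x (repr (\pi_Ord x)).
Proof.
have /eqmodP/asboolP[? ?] : repr (\pi_Ord x) = x %[mod Ord].
  by rewrite reprK.
by split.
Qed.

Definition Ord_le (a b : Ord) : bool := `[< tree_le (repr a) (repr b) >].

Lemma Ord_le_refl : reflexive Ord_le.
Proof. by move=> a; apply/asboolP; apply: tree_le_refl. Qed.

Lemma Ord_le_anti : antisymmetric Ord_le.
Proof.
move=> a b /andP[/asboolP ab /asboolP ba].
by rewrite -[a]reprK -[b]reprK; apply/eqmodP/asboolP.
Qed.

Lemma Ord_le_trans : transitive Ord_le.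
Proof.
move=> b a c /asboolP ab /asboolP bc; apply/asboolP.
exact: tree_le_trans bc.
Qed.

Fact Ord_display : Order.disp_t. Proof. exact: (Order.Disp tt tt). Qed.

HB.instance Definition _ :=
  Order.Le_isPOrder.Build Ord_display Ord Ord_le_refl Ord_le_anti Ord_le_trans.

Lemma Ord_le_total : total (<=%O : rel Ord).
Proof.
move=> a b; have [ab|/tree_ltW ba] := tree_le_total (repr a) (repr b).
  by apply/orP; left; apply/asboolP.
by apply/orP; right; apply/asboolP.
Qed.

HB.instance Definition _ := Order.POrder_isTotal.Build Ord_display Ord Ord_le_total.

Local Open Scope order_scope.

Lemma Ord_leP (a b : Ord) : reflect (tree_le (repr a) (repr b)) (a <= b).
Proof. exact: asboolP. Qed.

Lemma Ord_ltP (a b : Ord) : reflect (tree_lt (repr a) (repr b)) (a < b).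
Proof.
apply: (iffP idP) => [|lt].
  rewrite ltNge => /negP nle.
  have [le|//] := tree_le_total (repr b) (repr a).
  by case: nle; apply/Ord_leP.
rewrite ltNge; apply/negP => /Ord_leP le.
exact: (tree_lt_irr (tree_lt_le_trans lt le)).
Qed.

Lemma pi_leP (x y : tree) : reflect (tree_le x y) (\pi_Ord x <= \pi_Ord y).
Proof.
have [x1 x2] := tree_reprK x; have [y1 y2] := tree_reprK y.
apply: (iffP (Ord_leP _ _)) => xy.
  exact: tree_le_trans x2 (tree_le_trans xy y1).
exact: tree_le_trans x1 (tree_le_trans xy y2).
Qed.

Lemma pi_ltP (x y : tree) : reflect (tree_lt x y) (\pi_Ord x < \pi_Ord y).
Proof.
have [x1 x2] := tree_reprK x; have [y1 y2] := tree_reprK y.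
apply: (iffP (Ord_ltP _ _)) => xy.
  exact: tree_le_lt_trans x2 (tree_lt_le_trans xy y1).
exact: tree_le_lt_trans x1 (tree_lt_le_trans xy y2).
Qed.

Lemma Ord_wf : well_founded (fun a b : Ord => a < b).
Proof.
suff acc (x y : tree) : tree_le y x -> Acc (fun a b : Ord => a < b) (\pi_Ord y).
  by move=> a; rewrite -[a]reprK; apply: acc; apply: tree_le_refl.
elim: x y => U f IH y yx; constructor => b; rewrite -[b]reprK => /pi_ltP blt.
have [i bi] := tree_lt_le_trans blt yx.
exact: IH bi.
Qed.

Definition Ord0 : Ord := \pi_Ord tree0.
Definition Ord1 : Ord := \pi_Ord (treeS tree0).
Definition Ord_add (a b : Ord) : Ord :=
  \pi_Ord (tree_add (repr a) (repr b)).
(* a * n for a natural number n: a * 0 = 0 and a * (n + 1) = a * n + a *)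
Definition Ord_muln (a : Ord) (n : nat) : Ord := iter n (Ord_add^~ a) Ord0.
Definition Ord_wpow (a : Ord) : Ord := \pi_Ord (tree_wpow (repr a)).

Declare Scope Ord_scope.
Delimit Scope Ord_scope with ord.
Bind Scope Ord_scope with Ord.
Notation "a + b" := (Ord_add a b) : Ord_scope.
Notation "a * n" := (Ord_muln a n%N) : Ord_scope.
Notation "'ω^' a" := (Ord_wpow a) (at level 30, right associativity) : Ord_scope.
Notation "0" := Ord0 : Ord_scope.
Notation "1" := Ord1 : Ord_scope.
Local Open Scope Ord_scope.

Lemma pi_add (x y : tree) : \pi_Ord (tree_add x y) = \pi_Ord x + \pi_Ord y.
Proof.
have [x1 x2] := tree_reprK x; have [y1 y2] := tree_reprK y.
by apply/eqmodP/asboolP; split; apply: tree_add_le.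
Qed.

Lemma pi_muln (x : tree) n : \pi_Ord (tree_muln x n) = \pi_Ord x * n.
Proof. by elim: n => //= n <-; rewrite pi_add. Qed.

Lemma pi_wpow (x : tree) : \pi_Ord (tree_wpow x) = ω^ (\pi_Ord x).
Proof.
have [x1 x2] := tree_reprK x.
by apply/eqmodP/asboolP; split; apply: tree_wpow_le.
Qed.

Lemma Ord_ind (P : Ord -> Prop) : (forall x, P (\pi_Ord x)) -> forall a, P a.
Proof. by move=> Px a; rewrite -[a]reprK; apply: Px. Qed.

Lemma Ord_addA : associative Ord_add.
Proof.
move=> a b c; elim/Ord_ind: a => x; elim/Ord_ind: b => y; elim/Ord_ind: c => z; rewrite -!pi_add.
by apply/eqmodP/asboolP; apply: tree_addA.
Qed.

Lemma Ord_add0 : left_id Ord0 Ord_add.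
Proof.
move=> a; elim/Ord_ind: a => x; rewrite -pi_add; apply/eqmodP/asboolP.
by split; [apply: tree_add0t|apply: tree_le_addl].
Qed.

Lemma Ord_addr0 : right_id Ord0 Ord_add.
Proof.
move=> a; elim/Ord_ind: a => x; rewrite -pi_add; apply/eqmodP/asboolP.
by split; [apply: tree_addt0|apply: tree_le_addr].
Qed.

HB.instance Definition _ :=
  Monoid.isLaw.Build Ord Ord0 Ord_add Ord_addA Ord_add0 Ord_addr0.

Lemma Ord_le0 (a : Ord) : 0 <= a.
Proof. by elim/Ord_ind: a => x; apply/pi_leP. Qed.

Lemma Ord_le_addr (a b : Ord) : a <= a + b.
Proof.
elim/Ord_ind: a => x; elim/Ord_ind: b => y; rewrite -pi_add.
by apply/pi_leP; apply: tree_le_addr.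
Qed.

Lemma Ord_le_addl (a b : Ord) : b <= a + b.
Proof.
elim/Ord_ind: a => x; elim/Ord_ind: b => y; rewrite -pi_add.
by apply/pi_leP; apply: tree_le_addl.
Qed.

Lemma Ord_lt_add (a b z : Ord) :
  z < a + b <-> z < a \/ exists2 c, c < b & z = a + c.
Proof.
elim/Ord_ind: a => x; elim/Ord_ind: b => y; split; last first.
  move=> [zx|[c cy ->]]; first exact: lt_le_trans (Ord_le_addr _ _).
  elim/Ord_ind: c cy => c /pi_ltP cy; rewrite -!pi_add; apply/pi_ltP.
  case: x y cy => [U f] [J g] [j cj]; exists (inr j).
  exact: (@tree_add_le2l (Sup f)).
elim/Ord_ind: z => z; rewrite -pi_add => /pi_ltP.
elim: y => J g IH; case: x IH => U f IH [[i zi|j zj]].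
  by left; apply/pi_ltP; exists i.
have gj : tree_lt (g j) (Sup g) by exists j; apply: tree_le_refl.
have [xz|zx] := tree_le_total (tree_add (Sup f) (g j)) z.
  right; exists (\pi_Ord (g j)); first exact/pi_ltP.
  by rewrite -pi_add; apply/eqmodP/asboolP.
have [->|[c cg ->]] := IH j zx; [by left|right; exists c => //].
by apply: (lt_trans cg); apply/pi_ltP.
Qed.

Lemma Ord_lt1 (a : Ord) : a < 1 <-> a = 0.
Proof.
elim/Ord_ind: a => x; split=> [/pi_ltP[_ x0]|->].
  by apply/eqmodP/asboolP; split.
by apply/pi_ltP; exists tt.
Qed.

Lemma Ord_wpow_gt0 (a : Ord) : 0 < ω^ a.
Proof. by elim/Ord_ind: a => x; rewrite -pi_wpow; apply/pi_ltP/tree_wpow_gt0. Qed.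

Lemma Ord_wpow0 : ω^ 0 = 1.
Proof.
rewrite -pi_wpow; apply/eqmodP/asboolP; split; last by case; exists None.
by move=> [[[]]|]; exists tt.
Qed.

Lemma Ord_lt_wpow (a z : Ord) :
  z < ω^ a <-> z = 0 \/ exists b n, b < a /\ z <= ω^ b * n.
Proof.
elim/Ord_ind: a => x; split; last first.
  move=> [->|[b [n [+ zb]]]]; first exact: Ord_wpow_gt0.
  elim/Ord_ind: b zb => b zb /pi_ltP bx; apply: le_lt_trans zb _.
  rewrite -!pi_wpow -pi_muln; apply/pi_ltP.
  case: x bx => U f [i bi]; exists (Some (i, n)).
  by apply: tree_muln_le => //; apply: tree_wpow_le.
elim/Ord_ind: z => z; rewrite -pi_wpow => /pi_ltP.
case: x => U f [[[i n]|] zle]; last by left; apply/eqmodP/asboolP; split.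
right; exists (\pi_Ord (f i)), n; split.
  by apply/pi_ltP; exists i; apply: tree_le_refl.
by rewrite -pi_wpow -pi_muln; apply/pi_leP.
Qed.

Lemma Ord_wpow_le (a b : Ord) : a <= b -> ω^ a <= ω^ b.
Proof.
elim/Ord_ind: a => x; elim/Ord_ind: b => y /pi_leP xy; rewrite -!pi_wpow.
by apply/pi_leP; apply: tree_wpow_le.
Qed.

Lemma Ord_wpow_add_lt (a b c : Ord) : b < ω^ a -> c < ω^ a -> b + c < ω^ a.
Proof.
elim/Ord_ind: a => x; elim/Ord_ind: b => y; elim/Ord_ind: c => z.
rewrite -pi_wpow -pi_add => /pi_ltP yx /pi_ltP zx.
by apply/pi_ltP; apply: tree_wpow_add_lt.
Qed.

Local Close Scope Ord_scope.
Local Close Scope order_scope.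
Local Close Scope quotient_scope.

(* A small category presented by its morphisms: objects are identified with
   their identity morphisms, and [compose f g] is the morphism fg, defined when
   s(f) = r(g). *)
Record ordinalGraph := OrdinalGraph {
  paths :> Type;
  src : paths -> paths;
  rng : paths -> paths;
  compose : forall f g : paths, src f = rng g -> paths;
  deg : paths -> Ord;
  src_src : forall e, src (src e) = src e;
  rng_src : forall e, rng (src e) = src e;
  src_rng : forall e, src (rng e) = rng e;
  rng_rng : forall e, rng (rng e) = rng e;
  src_comp : forall f g (fg : src f = rng g), src (compose fg) = src g;
  rng_comp : forall f g (fg : src f = rng g), rng (compose fg) = rng f;
  compose_src : forall e (h : src e = rng (src e)), compose h = e;
  compose_rng : forall e (h : src (rng e) = rng e), compose h = e;
  composeA : forall e f g (ef : src e = rng f) (fg : src f = rng g)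
    (h1 : src (compose ef) = rng g) (h2 : src e = rng (compose fg)), compose h1 = compose h2;
  deg_src : forall e, deg (src e) = 0%ord;
  deg_comp : forall f g (fg : src f = rng g), deg (compose fg) = (deg f + deg g)%ord;
  factorization : forall e (a : Ord), (a <= deg e)%O ->
    exists! fg : paths * paths,
      deg fg.1 = a /\ exists h : src fg.1 = rng fg.2, e = compose h
}.

Section OrdinalGraphTheory.
Variable L : ordinalGraph.

Definition vertex (v : L) : Prop := src v = v.

(* e \in f L *)
Definition extends (f e : L) : Prop :=
  exists (g : L) (fg : src f = rng g), e = compose fg.

Definition exhaustive (v : L) (F : set L) : Prop :=
  (F `<=` [set e | rng e = v])%classic /\
  forall f : L, rng f = v -> exists e g : L, [/\ F e, extends e g & extends f g].

Lemma deg_rng (e : L) : deg (rng e) = 0%ord.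
Proof. by rewrite -src_rng deg_src. Qed.

Lemma compose_eq (f f' g g' : L) (fg : src f = rng g) (fg' : src f' = rng g') :
  f = f' -> g = g' -> compose fg = compose fg'.
Proof. by move=> ff' gg'; subst f' g'; congr compose; apply: Prop_irrelevance. Qed.

Section Subgraph.
Variable a : Ord.

Definition sub_path := {e : L | (deg e < (ω^ a)%ord)%O}.

Definition sub_mk (e : L) (elt : (deg e < (ω^ a)%ord)%O) : sub_path :=
  exist (fun e => is_true (deg e < (ω^ a)%ord)%O) e elt.

Lemma sub_src_subproof (e : sub_path) : (deg (src (val e)) < (ω^ a)%ord)%O.
Proof. by rewrite deg_src; exact: Ord_wpow_gt0. Qed.

Lemma sub_rng_subproof (e : sub_path) : (deg (rng (val e)) < (ω^ a)%ord)%O.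
Proof. by rewrite deg_rng; exact: Ord_wpow_gt0. Qed.

Definition sub_src (e : sub_path) : sub_path := sub_mk (sub_src_subproof e).
Definition sub_rng (e : sub_path) : sub_path := sub_mk (sub_rng_subproof e).

Lemma sub_comp_subproof (f g : sub_path) (fg : sub_src f = sub_rng g) :
  (deg (compose (congr1 val fg : src (val f) = rng (val g))) < (ω^ a)%ord)%O.
Proof. by rewrite deg_comp; exact: Ord_wpow_add_lt (valP f) (valP g). Qed.

Definition sub_comp (f g : sub_path) (fg : sub_src f = sub_rng g) : sub_path :=
  sub_mk (sub_comp_subproof fg).

Definition sub_deg (e : sub_path) : Ord := deg (val e).

Lemma sub_factorization (e : sub_path) (b : Ord) : (b <= sub_deg e)%O ->
  exists! fg : sub_path * sub_path,
    sub_deg fg.1 = b /\ exists h : sub_src fg.1 = sub_rng fg.2, e = sub_comp h.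
Proof.
move=> /factorization[[f g] /= [[fb [fg efg]] fguniq]].
have edeg := valP e; have degE : deg (val e) = (deg f + deg g)%ord.
  by rewrite -(deg_comp fg) -efg.
have flt : (deg f < (ω^ a)%ord)%O.
  by apply: le_lt_trans edeg; rewrite degE; apply: Ord_le_addr.
have glt : (deg g < (ω^ a)%ord)%O.
  by apply: le_lt_trans edeg; rewrite degE; apply: Ord_le_addl.
pose f' := sub_mk flt; pose g' := sub_mk glt.
exists (f', g'); split => /=.
  split=> //; have fg' : sub_src f' = sub_rng g' by apply: val_inj.
  by exists fg'; apply: val_inj; apply: (etrans efg); apply: compose_eq.
move=> [f1 g1] /= [f1b [h ef1g1]].
have /fguniq[ff1 gg1] : deg (val f1, val g1).1 = b /\
    exists h : src (val f1, val g1).1 = rng (val f1, val g1).2, val e = compose h.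
  by split=> //; exists (congr1 val h); rewrite ef1g1.
by congr pair; apply: val_inj.
Qed.

Definition subgraph : ordinalGraph.
refine (@OrdinalGraph sub_path sub_src sub_rng sub_comp sub_deg
  _ _ _ _ _ _ _ _ _ _ _ sub_factorization).
- by move=> e; apply: val_inj; apply: src_src.
- by move=> e; apply: val_inj; apply: rng_src.
- by move=> e; apply: val_inj; apply: src_rng.
- by move=> e; apply: val_inj; apply: rng_rng.
- by move=> f g fg; apply: val_inj; apply: src_comp.
- by move=> f g fg; apply: val_inj; apply: rng_comp.
- by move=> e h; apply: val_inj; apply: compose_src.
- by move=> e h; apply: val_inj; apply: compose_rng.
- by move=> e f g ef fg h1 h2; apply: val_inj; apply: composeA.
- by move=> e; apply: deg_src.
- by move=> f g fg; apply: deg_comp.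
Defined.

End Subgraph.

Lemma sub_incl_subproof (a b : Ord) (ab : (a <= b)%O) (e : subgraph a) :
  (deg (val (e : sub_path a)) < (ω^ b)%ord)%O.
Proof. exact: lt_le_trans (valP (e : sub_path a)) (Ord_wpow_le ab). Qed.

Definition sub_incl (a b : Ord) (ab : (a <= b)%O) (e : subgraph a) : subgraph b :=
  sub_mk (sub_incl_subproof ab e).

End OrdinalGraphTheory.

Arguments vertex {L} v.
Arguments extends {L} f e.
Arguments exhaustive {L} v F.
Arguments subgraph : clear implicits.

Local Open Scope classical_set_scope.
Local Open Scope complex_scope.
Local Open Scope ring_scope.

(* Multiplication is not assumed unital: the library's ring structures all have
   a unit, hence the separate product. *)
HB.mixin Record isCstarAlgebra (R : realType) A & CompleteNormedModule R[i] A := {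
  cmul : A -> A -> A;
  cstar : A -> A;
  cmulA : associative cmul;
  cmulDl : left_distributive cmul +%R;
  cmulDr : right_distributive cmul +%R;
  cscaleAl : forall (c : R[i]) x y, c *: cmul x y = cmul (c *: x) y;
  cscaleAr : forall (c : R[i]) x y, c *: cmul x y = cmul x (c *: y);
  cstarK : involutive cstar;
  cstarD : {morph cstar : x y / x + y};
  cstarZ : forall (c : R[i]) x, cstar (c *: x) = Num.conj c *: cstar x;
  cstarM : forall x y, cstar (cmul x y) = cmul (cstar y) (cstar x);
  cnormM : forall x y, `|cmul x y| <= `|x| * `|y|;
  cnorm_star : forall x, `|cmul (cstar x) x| = `|x| ^+ 2
}.

#[short(type="cstarAlgebra")]
HB.structure Definition CstarAlgebra (R : realType) :=
  {A of CompleteNormedModule R[i] A & isCstarAlgebra R A}.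

Declare Scope cstar_scope.
Delimit Scope cstar_scope with cstar.
Notation "x ⋅ y" := (cmul x y) (at level 40, left associativity) : cstar_scope.
Notation "x ^*" := (cstar x) : cstar_scope.
Local Open Scope cstar_scope.

Section CstarAlgebraDefs.
Variable R : realType.

Record is_star_hom (A B : cstarAlgebra R) (f : A -> B) : Prop := IsStarHom {
  star_homP : forall (c : R[i]) x y, f (c *: x + y) = c *: f x + f y;
  star_homM : forall x y, f (x ⋅ y) = f x ⋅ f y;
  star_hom_star : forall x, f (x^*) = (f x)^*
}.

Definition positive (A : cstarAlgebra R) (x : A) : Prop := exists y : A, x = y^* ⋅ y.

Definition is_projection (A : cstarAlgebra R) (p : A) : Prop :=
  p^* = p /\ p ⋅ p = p.

Definition proj_le (A : cstarAlgebra R) (p q : A) : Prop := p ⋅ q = p.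

Definition is_join (A : cstarAlgebra R) (P : set A) (t : A) : Prop :=
  [/\ is_projection t,
      forall p, P p -> proj_le p t
    & forall q, is_projection q -> (forall p, P p -> proj_le p q) -> proj_le t q].

Record is_submodule (V : lmodType R[i]) (S : set V) : Prop := IsSubmodule {
  submodule0 : S 0;
  submoduleP : forall (c : R[i]) x y, S x -> S y -> S (c *: x + y)
}.

Record is_cstar_subalgebra (A : cstarAlgebra R) (S : set A) : Prop := IsCstarSubalgebra {
  subalgebra_submodule : is_submodule S;
  subalgebraM : forall x y, S x -> S y -> S (x ⋅ y);
  subalgebra_star : forall x, S x -> S (x^*);
  subalgebra_closed : closed S
}.

Definition lin_span (V : lmodType R[i]) (S : set V) : set V :=
  [set x | exists (n : nat) (c : 'I_n -> R[i]) (v : 'I_n -> V),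
     (forall i, S (v i)) /\ x = \sum_(i < n) c i *: v i].

Definition closed_span (V : normedModType R[i]) (S : set V) : set V :=
  closure (lin_span S).

End CstarAlgebraDefs.

Section Submodule.
Context (R : realType) (V : lmodType R[i]) (S : set V) (hS : is_submodule S).

Definition submodule_pred of is_submodule S : {pred V} := fun x => `[< S x >].

Lemma submodule_pred_closed : submod_closed (submodule_pred hS).
Proof.
split; first by apply/asboolP/(submodule0 hS).
by move=> c x y /asboolP Sx /asboolP Sy; apply/asboolP/(submoduleP hS).
Qed.

HB.instance Definition _ :=
  GRing.isSubmodClosed.Build R[i] V (submodule_pred hS) submodule_pred_closed.

Definition submodule_type : Type := {x : V | x \in submodule_pred hS}.

HB.instance Definition _ := SubChoice.on submodule_type.
HB.instance Definition _ := [SubChoice_isSubLmodule of submodule_type by <:].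

End Submodule.

Section Subalgebra.
Context (R : realType) (A : cstarAlgebra R) (S : set A) (hS : is_cstar_subalgebra S).

Definition subalgebra_type : Type := submodule_type (subalgebra_submodule hS).
Local Notation T := subalgebra_type.

HB.instance Definition _ := GRing.SubLmodule.on T.

Lemma subalgebra_valP (x : T) : S (val x).
Proof. by have /asboolP := valP x. Qed.

Definition subalgebra_mk (x : A) (Sx : S x) : T := exist _ x (asboolT Sx).

Definition subalgebra_norm (x : T) : R[i] := `|val x|.

Lemma subalgebra_normD (x y : T) :
  subalgebra_norm (x + y) <= subalgebra_norm x + subalgebra_norm y.
Proof. exact: ler_normD. Qed.

Lemma subalgebra_normZ (c : R[i]) (x : T) :
  subalgebra_norm (c *: x) = `|c| * subalgebra_norm x.
Proof. exact: normrZ. Qed.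

Lemma subalgebra_norm_eq0 (x : T) : subalgebra_norm x = 0 -> x = 0.
Proof. by move=> /normr0_eq0 x0; apply: val_inj. Qed.

HB.instance Definition _ := Lmodule_isNormed.Build R[i] T
  subalgebra_normD subalgebra_normZ subalgebra_norm_eq0.

Lemma subalgebra_complete (F : set_system T) :
  ProperFilter F -> cauchy F -> cvg F.
Proof.
move=> FF /cauchy_ballP Fc.
pose val' (x : T) : A := val x.
have /cvg_ex[/= l Fl] : cvg (val' @ F).
  apply: cauchy_cvg; apply/cauchy_ballP => e e0.
  have [[P Q] /= [FP FQ] PQ] := Fc e e0.
  exists ([set val' x | x in P], [set val' x | x in Q]) => /=.
    by split; [apply: filterS FP|apply: filterS FQ] => x Px; exists x.
  move=> [_ _] /= [[x Px <-] [y Qy <-]].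
  have := PQ (x, y) (conj Px Qy).
  by rewrite /= -!ball_normE.
have Sl : S l.
  have SF : \forall x \near F, S (val' x).
    by apply: nearW => x; apply: subalgebra_valP.
  exact: (@closed_cvg _ _ _ FF val' S (subalgebra_closed hS) SF l Fl).
apply/cvg_ex; exists (subalgebra_mk Sl).
apply/cvgrPdist_lt => e e0; move/cvgrPdist_lt: Fl => /(_ e e0).
exact.
Qed.

HB.instance Definition _ := Uniform_isComplete.Build T subalgebra_complete.

Definition subalgebra_mul (x y : T) : T :=
  subalgebra_mk (subalgebraM hS (subalgebra_valP x) (subalgebra_valP y)).

Definition subalgebra_cstar (x : T) : T :=
  subalgebra_mk (subalgebra_star hS (subalgebra_valP x)).

Lemma subalgebra_mulA : associative subalgebra_mul.
Proof. by move=> x y z; apply: val_inj; apply: cmulA. Qed.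

Lemma subalgebra_mulDl : left_distributive subalgebra_mul +%R.
Proof. by move=> x y z; apply: val_inj; apply: cmulDl. Qed.

Lemma subalgebra_mulDr : right_distributive subalgebra_mul +%R.
Proof. by move=> x y z; apply: val_inj; apply: cmulDr. Qed.

Lemma subalgebra_scaleAl (c : R[i]) (x y : T) :
  c *: subalgebra_mul x y = subalgebra_mul (c *: x) y.
Proof. by apply: val_inj; apply: cscaleAl. Qed.

Lemma subalgebra_scaleAr (c : R[i]) (x y : T) :
  c *: subalgebra_mul x y = subalgebra_mul x (c *: y).
Proof. by apply: val_inj; apply: cscaleAr. Qed.

Lemma subalgebra_cstarK : involutive subalgebra_cstar.
Proof. by move=> x; apply: val_inj; apply: cstarK. Qed.

Lemma subalgebra_cstarD : {morph subalgebra_cstar : x y / x + y}.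
Proof. by move=> x y; apply: val_inj; apply: cstarD. Qed.

Lemma subalgebra_cstarZ (c : R[i]) (x : T) :
  subalgebra_cstar (c *: x) = Num.conj c *: subalgebra_cstar x.
Proof. by apply: val_inj; apply: cstarZ. Qed.

Lemma subalgebra_cstarM (x y : T) :
  subalgebra_cstar (subalgebra_mul x y) =
  subalgebra_mul (subalgebra_cstar y) (subalgebra_cstar x).
Proof. by apply: val_inj; apply: cstarM. Qed.

Lemma subalgebra_cnormM (x y : T) : `|subalgebra_mul x y| <= `|x| * `|y|.
Proof. exact: cnormM. Qed.

Lemma subalgebra_cnorm_star (x : T) :
  `|subalgebra_mul (subalgebra_cstar x) x| = `|x| ^+ 2.
Proof. exact: cnorm_star. Qed.

HB.instance Definition _ := isCstarAlgebra.Build R T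
  subalgebra_mulA subalgebra_mulDl subalgebra_mulDr
  subalgebra_scaleAl subalgebra_scaleAr
  subalgebra_cstarK subalgebra_cstarD subalgebra_cstarZ subalgebra_cstarM
  subalgebra_cnormM subalgebra_cnorm_star.

End Subalgebra.

Section Correspondence.
Variable R : realType.

Definition module_norm (A : cstarAlgebra R) (X : Type) (inner : X -> X -> A)
  (x : X) : R[i] := sqrtC `|inner x x|.

Definition module_complete (A : cstarAlgebra R) (X : lmodType R[i])
    (inner : X -> X -> A) : Prop :=
  forall u : nat -> X,
    (forall e : R[i], 0 < e -> exists N : nat, forall m n : nat,
       (N <= m)%N -> (N <= n)%N -> module_norm inner (u m - u n) < e) ->
    exists l : X, forall e : R[i], 0 < e -> exists N : nat, forall n : nat,
       (N <= n)%N -> module_norm inner (u n - l) < e.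

(* right Hilbert A-module; the inner product is linear in the second variable *)
Record is_hilbert_module (A : cstarAlgebra R) (X : lmodType R[i])
    (act : X -> A -> X) (inner : X -> X -> A) : Prop := IsHilbertModule {
  hilbert_actDl : forall x y a, act (x + y) a = act x a + act y a;
  hilbert_actDr : forall x a b, act x (a + b) = act x a + act x b;
  hilbert_actZl : forall (c : R[i]) x a, act (c *: x) a = c *: act x a;
  hilbert_actZr : forall (c : R[i]) x a, act x (c *: a) = c *: act x a;
  hilbert_actM : forall x a b, act x (a ⋅ b) = act (act x a) b;
  hilbert_innerP : forall (c : R[i]) x y z,
    inner x (c *: y + z) = c *: inner x y + inner x z;
  hilbert_inner_act : forall x y a, inner x (act y a) = inner x y ⋅ a;
  hilbert_inner_star : forall x y, (inner x y)^* = inner y x;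
  hilbert_inner_positive : forall x, positive (inner x x);
  hilbert_inner_eq0 : forall x, inner x x = 0 -> x = 0;
  hilbert_inner_complete : module_complete inner
}.

Definition is_adjoint (A : cstarAlgebra R) (X : Type) (inner : X -> X -> A)
    (t s : X -> X) : Prop :=
  forall x y, inner (t x) y = inner x (s y).

Definition adjointable (A : cstarAlgebra R) (X : Type) (inner : X -> X -> A)
    (t : X -> X) : Prop :=
  exists s, is_adjoint inner t s.

(* The last three fields say that phi is a *-homomorphism into the *-algebra of
   adjointable operators, whose operations are pointwise. *)
Record is_correspondence (A : cstarAlgebra R) (X : lmodType R[i])
    (act : X -> A -> X) (inner : X -> X -> A) (phi : A -> X -> X) : Prop :=
    IsCorrespondence {
  corr_hilbert : is_hilbert_module act inner;
  corr_adjointable : forall a, adjointable inner (phi a);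
  corrP : forall (c : R[i]) a b x, phi (c *: a + b) x = c *: phi a x + phi b x;
  corrM : forall a b x, phi (a ⋅ b) x = phi a (phi b x);
  corr_star : forall a, is_adjoint inner (phi a) (phi (a^*))
}.

End Correspondence.

Section GraphAlgebra.
Variable R : realType.

Record graph_relations (L : ordinalGraph) (B : cstarAlgebra R) (T : L -> B) : Prop :=
    GraphRelations {
  graph_rel_src : forall e, (T e)^* ⋅ T e = T (src e);
  graph_rel_comp : forall e f (ef : src e = rng f), T e ⋅ T f = T (compose ef);
  graph_rel_extl : forall e f, extends f e ->
    T e ⋅ (T e)^* ⋅ (T f ⋅ (T f)^*) = T e ⋅ (T e)^*;
  graph_rel_extr : forall e f, extends e f ->
    T e ⋅ (T e)^* ⋅ (T f ⋅ (T f)^*) = T f ⋅ (T f)^*;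
  graph_rel_orth : forall e f, ~ extends f e -> ~ extends e f ->
    T e ⋅ (T e)^* ⋅ (T f ⋅ (T f)^*) = 0;
  graph_rel_join : forall (v : L) (F : set L),
    vertex v -> finite_set F -> exhaustive v F ->
    is_join [set T e ⋅ (T e)^* | e in F] (T v)
}.

(* (B, T) is the universal C*-algebra on generators T subject to the relations;
   that T generates B is the uniqueness part. *)
Definition is_graph_algebra (L : ordinalGraph) (B : cstarAlgebra R) (T : L -> B) : Prop :=
  graph_relations T /\
  forall (D : cstarAlgebra R) (S : L -> D), graph_relations S ->
    exists! pi : B -> D, is_star_hom pi /\ forall e, pi (T e) = S e.

End GraphAlgebra.

(* Main.v *)
(* Paths of length in [omega^a, omega^a * 2) factor through paths of length
   omega^a, so [T_f^* T_g] is a generator, the adjoint of one, or [0]; ordinal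
   arithmetic then shows that [A X], [X A] and [X^* X] land in [X], [X] and [A],
   where [A] is the closed span of the [T_g T_h^*] with short [g] and [h], by the
   uniqueness part of the universal property of O(L_a).

   Two facts of C*-theory remain: the range of a *-homomorphism is closed, and
   [x^* x] has a square root in [A]. Both come without spectra from one device.
   For a self-adjoint [g] of norm at most [1], an iteration gives [b] with
   [(1 - b)^2 = 1 - g^2], so that [g + i (1 - b)] is unitary and the Chebyshev
   polynomials [C_1, C_2, C_3] take values of norm at most [1] at [g].
   - This survives any *-homomorphism, which is thus contractive.
   - [C_2] shows that squares satisfy [|M - h| <= M] for some [M > 0]; this
     describes a convex cone whose elements have square roots.
   - [C_3] rules out [z^* z = - g^2 <> 0], hence [x^* x] is in the cone.
   - [- M C_3 (h / M) / 3] replaces a large lift [h] of an element of the range by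
     a smaller one, up to a small error, hence the range is closed. *)
From HB Require Import structures.
Require Import Defs.
From mathcomp Require Import all_boot all_order all_algebra.
From mathcomp Require Import all_classical all_reals all_analysis.
From mathcomp Require Import complex ring lra.

Set Implicit Arguments.
Unset Strict Implicit.
Unset Printing Implicit Defensive.

Import Order.TTheory GRing.Theory Num.Theory.
Import numFieldNormedType.Exports.

Local Open Scope classical_set_scope.
Local Open Scope complex_scope.
Local Open Scope ring_scope.
Local Open Scope cstar_scope.

(** * Real-valued norms, limits and closures *)

Lemma cvgn_uniq (K : numFieldType) (V : pseudoMetricNormedZmodType K) (u : nat -> V) (l m : V) :
  u n @[n --> \oo] --> l -> u n @[n --> \oo] --> m -> l = m.
Proof. exact: (cvg_unique (@norm_hausdorff _ _)). Qed.

Section RealNorm.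
Variables (R : realType).

(** The norm takes values in [R[i]]; its real part carries the same information by [normE] and opens
    estimates to [lra] and [nra]. *)
Definition nrm (V : normedModType R[i]) (x : V) : R := complex.Re `|x|.

Section NormedModule.
Variable V : normedModType R[i].
Implicit Types (x y z : V) (c : R[i]).

Lemma normE x : `|x| = (nrm x)%:C.
Proof. by rewrite /nrm RRe_real // ger0_real. Qed.

Lemma nrm_ge0 x : 0 <= nrm x.
Proof. by rewrite -lecR -normE; exact: normr_ge0. Qed.

Lemma nrmD x y : nrm (x + y) <= nrm x + nrm y.
Proof. by rewrite -lecR rmorphD /= -!normE ler_normD. Qed.

Lemma nrmN x : nrm (- x) = nrm x.
Proof. by rewrite /nrm normrN. Qed.

Lemma nrmB x y : nrm (x - y) <= nrm x + nrm y.
Proof. by rewrite -(nrmN y) nrmD. Qed.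

Lemma nrm_distC x y : nrm (x - y) = nrm (y - x).
Proof. by rewrite -nrmN opprB. Qed.

Lemma nrm0 : nrm (0 : V) = 0.
Proof. by rewrite /nrm normr0. Qed.

Lemma nrm0_eq0 x : nrm x <= 0 -> x = 0.
Proof.
move=> x0; apply/normr0_eq0; rewrite normE; congr (_ %:C).
by apply/le_anti; rewrite x0 nrm_ge0.
Qed.

Lemma nrm_gt0 x : x != 0 -> 0 < nrm x.
Proof.
move=> x0; rewrite lt_neqAle nrm_ge0 andbT eq_sym; apply: contra x0 => /eqP x0.
by apply/eqP/nrm0_eq0; rewrite x0.
Qed.

Lemma nrmZ c x : nrm (c *: x) = complex.Re `|c| * nrm x.
Proof.
rewrite /nrm normrZ !normE [`|c|]normc_def /= mul0r subr0.
by [].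
Qed.

Lemma nrmZr (r : R) x : 0 <= r -> nrm (r%:C *: x) = r * nrm x.
Proof. by move=> r0; rewrite nrmZ ger0_norm ?lecR. Qed.

Lemma nrmZi x : nrm ('i *: x) = nrm x.
Proof. by rewrite nrmZ normc_def /= expr0n /= add0r expr1n sqrtr1 mul1r. Qed.

Lemma cvg_nrmP (u : nat -> V) (l : V) :
  u n @[n --> \oo] --> l <->
  forall e : R, 0 < e -> exists N, forall n, (N <= n)%N -> nrm (u n - l) < e.
Proof.
split=> [/cvgrPdist_lt ul e e0|ul].
  have /ul[N _ uN] : 0 < e%:C by rewrite ltcR.
  exists N => n Nn; rewrite -ltcR -normE distrC; exact: uN.
apply/cvgrPdist_lt => e e0.
have eR : (complex.Re e)%:C = e by rewrite RRe_real // gtr0_real.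
have /ul[N uN] : 0 < complex.Re e by rewrite -ltcR eR.
by exists N => // n Nn /=; rewrite distrC normE -eR ltcR; apply: uN.
Qed.

Lemma closure_nrmP (S : set V) x :
  closure S x <-> forall e : R, 0 < e -> exists2 y, S y & nrm (x - y) < e.
Proof.
split=> [Sx e e0|Sx].
  have /Sx[y [Sy xy]] : nbhs x (ball x e%:C) by apply: nbhsx_ballx; rewrite ltcR.
  exists y => //; rewrite -ltcR -normE.
  by move: xy; rewrite -ball_normE.
move=> B /nbhs_ballP[e /= e0 xB].
have eR : (complex.Re e)%:C = e by rewrite RRe_real // gtr0_real.
have [|y Sy xy] := Sx (complex.Re e); first by rewrite -ltcR eR.
exists y; split=> //; apply: xB.
by rewrite -ball_normE /= normE -eR ltcR.
Qed.

End NormedModule.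

Lemma nrm_complete (V : completeNormedModType R[i]) (u : nat -> V) :
  (forall e : R, 0 < e -> exists N : nat, forall m n : nat,
     (N <= m)%N -> (N <= n)%N -> nrm (u m - u n) < e) ->
  cvgn u.
Proof.
move=> uc; apply: cauchy_cvg; apply/cauchy_ballP => e e0.
have eR : (complex.Re e)%:C = e by rewrite RRe_real // gtr0_real.
have /uc[N uN] : 0 < complex.Re e by rewrite -ltcR eR.
exists ([set u n | n in [set n | (N <= n)%N]], [set u n | n in [set n | (N <= n)%N]]) => /=.
  by split; exists N => // n Nn; exists n.
move=> [_ _] /= [[m Nm <-] [n Nn <-]].
by rewrite -ball_normE /= normE -eR ltcR; apply: uN.
Qed.

Lemma closed_nrmP (V : normedModType R[i]) (S : set V) :
  (forall x, (forall e : R, 0 < e -> exists2 y, S y & nrm (x - y) < e) -> S x) ->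
  closed S.
Proof. by move=> h x /closure_nrmP; apply: h. Qed.

(** The increments telescope against those of [b], which is nondecreasing and bounded, hence
    convergent; so [u] is Cauchy. *)
Lemma cvg_dominated (V : completeNormedModType R[i]) (u : nat -> V) (b : nat -> R) (B : R) :
  (forall n, nrm (u n.+1 - u n) <= b n.+1 - b n) -> (forall n, b n <= B) -> cvgn u.
Proof.
move=> ub bB.
have ubk n k : nrm (u (n + k)%N - u n) <= b (n + k)%N - b n.
  elim: k => [|k IH]; first by rewrite addn0 !subrr nrm0.
  rewrite addnS -[u _ - _](subrKA (u (n + k)%N)).
  apply: le_trans (nrmD _ _) _; have := ub (n + k)%N; lra.
have bnd : nondecreasing_seq b.
  apply/nondecreasing_seqP => n.
  by rewrite -subr_ge0; apply: le_trans (ub n); apply: nrm_ge0.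
have /nondecreasing_is_cvgn bc := bnd.
have {bc} /cvgrPdist_lt bc : b n @[n --> \oo] --> limn b.
  by apply: bc; exists B => _ [n _ <-].
apply: nrm_complete => e e0.
have [|N _ bN] := bc (e / 2); first by rewrite divr_gt0.
exists N.
suff main m n : (N <= m)%N -> (m <= n)%N -> nrm (u m - u n) < e.
  move=> m n Nm Nn; have [mn|/ltnW nm] := leqP m n; first exact: main.
  by rewrite nrm_distC; apply: main.
move=> Nm mn; rewrite -(subnKC mn) nrm_distC.
apply: le_lt_trans (ubk _ _) _.
have := bN _ Nm; have /= := bN _ (leq_trans Nm mn).
rewrite (subnKC mn) !ltr_norml => /andP[? ?] /andP[? ?]; lra.
Qed.

End RealNorm.

(** * Elementary C*-algebra: signs, isometry of the involution, continuity *)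

Section CstarBasics.
Variables (R : realType) (A : cstarAlgebra R).
Implicit Types (x y z : A) (c : R[i]).

Lemma cmul0l x : 0 ⋅ x = 0.
Proof. by apply: (addrI (0 ⋅ x)); rewrite -cmulDl !addr0. Qed.

Lemma cmul0r x : x ⋅ 0 = 0.
Proof. by apply: (addrI (x ⋅ 0)); rewrite -cmulDr !addr0. Qed.

Lemma cmulNl x y : - x ⋅ y = - (x ⋅ y).
Proof. by apply: (addrI (x ⋅ y)); rewrite -cmulDl !subrr cmul0l. Qed.

Lemma cmulNr x y : x ⋅ - y = - (x ⋅ y).
Proof. by apply: (addrI (x ⋅ y)); rewrite -cmulDr !subrr cmul0r. Qed.

Lemma cmulBl x y z : (x - y) ⋅ z = x ⋅ z - y ⋅ z.
Proof. by rewrite cmulDl cmulNl. Qed.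

Lemma cmulBr x y z : z ⋅ (x - y) = z ⋅ x - z ⋅ y.
Proof. by rewrite cmulDr cmulNr. Qed.

Lemma cstar0 : (0 : A)^* = 0.
Proof. by apply: (addrI (cstar (0 : A))); rewrite -cstarD !addr0. Qed.

Lemma cstarN x : (- x)^* = - cstar x.
Proof. by apply: (addrI (cstar x)); rewrite -cstarD !subrr cstar0. Qed.

Lemma cstarB x y : (x - y)^* = cstar x - cstar y.
Proof. by rewrite cstarD cstarN. Qed.

Lemma cstarMn x n : (x *+ n)^* = cstar x *+ n.
Proof. by elim: n => [|n IH]; rewrite ?cstar0 // !mulrS cstarD IH. Qed.

Lemma nrmM x y : nrm (x ⋅ y) <= nrm x * nrm y.
Proof. by rewrite -lecR rmorphM /= -!normE cnormM. Qed.

Lemma nrm_cstarM x : nrm (x^* ⋅ x) = nrm x ^+ 2.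
Proof. by apply: complexI; rewrite rmorphXn /= -!normE cnorm_star. Qed.

Lemma nrm_sq x : x^* = x -> nrm (x ⋅ x) = nrm x ^+ 2.
Proof. by move=> {1}<-; apply: nrm_cstarM. Qed.

(** One factor [nrm x] cancels from [nrm x ^+ 2 = nrm (x^* ⋅ x) <= nrm (cstar x) * nrm x]. *)
Lemma nrm_le_star x : nrm x <= nrm (cstar x).
Proof.
have [->|x0] := eqVneq x 0; first by rewrite cstar0.
by rewrite -(ler_pM2r (nrm_gt0 x0)) -expr2 -nrm_cstarM nrmM.
Qed.

Lemma nrm_star x : nrm (cstar x) = nrm x.
Proof. by apply/le_anti; rewrite nrm_le_star andbT -{2}(cstarK x) nrm_le_star. Qed.

Lemma nrm_mul_cstar x : nrm (x ⋅ x^*) = nrm x ^+ 2.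
Proof. by rewrite -{1}(cstarK x) nrm_cstarM nrm_star. Qed.

Lemma cstarM_eq0 x : x^* ⋅ x = 0 -> x = 0.
Proof.
move=> x0; apply: nrm0_eq0; have := nrm_cstarM x.
by rewrite x0 nrm0 => /esym/eqP; rewrite sqrf_eq0 => /eqP ->.
Qed.

Lemma cvg_cstar (u : nat -> A) l :
  u n @[n --> \oo] --> l -> (u n)^* @[n --> \oo] --> l^*.
Proof.
move=> /cvg_nrmP ul; apply/cvg_nrmP => e /ul[N uN].
by exists N => n /uN; rewrite -cstarB nrm_star.
Qed.

Lemma cvg_cmul (u v : nat -> A) l m :
  u n @[n --> \oo] --> l -> v n @[n --> \oo] --> m ->
  u n ⋅ v n @[n --> \oo] --> l ⋅ m.
Proof.
move=> /cvg_nrmP ul /cvg_nrmP vm; apply/cvg_nrmP => e e0.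
(* [K] bounds [nrm (v n) + nrm l] once [nrm (v n - m) <= 1], so errors below [e / (2 * K)] in both
   factors suffice. *)
pose K := 1 + nrm m + nrm l.
have K0 : 1 <= K by rewrite /K -addrA lerDl addr_ge0 ?nrm_ge0.
have d0 : 0 < Num.min 1 (e / (2 * K)) by rewrite lt_min ltr01 divr_gt0 //; nra.
have [N uN] := ul _ d0; have [N' vN] := vm _ d0.
exists (maxn N N') => n; rewrite geq_max => /andP[/uN + /vN].
rewrite !lt_min => /andP[_ un] /andP[v1 vn].
rewrite -[_ - _](subrKA (l ⋅ v n)) -cmulBl -cmulBr.
apply: le_lt_trans (nrmD _ _) _.
have vnm : nrm (v n) <= 1 + nrm m.
  by rewrite -[v n](subrK m); apply: le_trans (nrmD _ _) _; rewrite lerD2r ltW.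
have eK : e = 2 * (K * (e / (2 * K))) by field; lra.
set d := e / (2 * K) in un vn eK.
have := nrmM (u n - l) (v n); have := nrmM l (v n - m).
have := nrm_ge0 (u n - l); have := nrm_ge0 (v n - m).
have := nrm_ge0 l; have := nrm_ge0 m; have := nrm_ge0 (v n).
move: vnm un vn K0; rewrite eK /K.
move: (nrm (u n - l)) (nrm (v n - m)) (nrm l) (nrm m) (nrm (v n)) => p q a b c.
move=> *; nra.
Qed.

End CstarBasics.

Lemma cvg_nrm_le (R : realType) (V : normedModType R[i]) (u : nat -> V) l (K : R) :
  u n @[n --> \oo] --> l -> (forall n, nrm (u n) <= K) -> nrm l <= K.
Proof.
move=> /cvg_nrmP ul uK; apply/ler_addgt0Pr => e /ul[N /(_ N (leqnn _)) uN].
rewrite -[l](subrK (u N)) addrC; apply: le_trans (nrmD _ _) _.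
by rewrite lerD // nrm_distC ltW.
Qed.

(** * The unitization and bounds on its left action *)

Section Unitization.
Variables (R : realType) (A : cstarAlgebra R).

(* Elements [(c, x)] stand for the formal sums [c + x]. No norm is put on them:
   their size is measured by their action [uact] on [A], through [bnd]. *)
Definition unitz := (R[i]^o * A)%type.
HB.instance Definition _ := GRing.Lmodule.on unitz.

Implicit Types (u v w : unitz) (x y z : A).

Definition umul u v : unitz := (u.1 * v.1, u.1 *: v.2 + v.1 *: u.2 + u.2 ⋅ v.2).
Definition uone : unitz := (1, 0).

Lemma umulA : associative umul.
Proof.
move=> [a x] [b y] [c z]; congr pair => /=; first by rewrite mulrA.
rewrite !scalerDr !cmulDl !cmulDr -!cscaleAl -!cscaleAr !scalerA cmulA.
rewrite (mulrC a c) (mulrC b c) -!addrA; congr (_ + (_ + _)).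
by rewrite addrCA; congr (_ + _); rewrite (addrCA (b *: _)) addrCA.
Qed.

Lemma umul1u : left_id uone umul.
Proof. by case=> a x; rewrite /umul /= mul1r scale1r scaler0 cmul0l !addr0. Qed.

Lemma umulu1 : right_id uone umul.
Proof. by case=> a x; rewrite /umul /= mulr1 scale1r scaler0 cmul0r add0r addr0. Qed.

Lemma umulDl : left_distributive umul +%R.
Proof.
move=> [a x] [b y] [c z]; congr pair => /=; first by rewrite mulrDl.
by rewrite scalerDl scalerDr cmulDl !(addrACA _ _ (_ + _)) (addrACA (a *: z)).
Qed.

Lemma umulDr : right_distributive umul +%R.
Proof.
move=> [a x] [b y] [c z]; congr pair => /=; first by rewrite mulrDr.
by rewrite scalerDl scalerDr cmulDr !(addrACA _ _ (_ + _)) (addrACA (a *: y)).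
Qed.

HB.instance Definition _ :=
  GRing.Zmodule_isPzRing.Build unitz umulA umul1u umulu1 umulDl umulDr.

Lemma uscaleAl (c : R[i]) u v : c *: (u * v) = (c *: u) * v.
Proof.
case: u v => [a x] [b y]; congr pair => /=; first by rewrite scalerAl.
by rewrite !scalerDr !scalerA cscaleAl /GRing.scale /= (mulrC c b).
Qed.

Lemma uscaleAr (c : R[i]) u v : c *: (u * v) = u * (c *: v).
Proof.
case: u v => [a x] [b y]; congr pair => /=; first by rewrite scalerAr.
by rewrite !scalerDr !scalerA cscaleAr /GRing.scale /= (mulrC c a).
Qed.

Definition ustar u : unitz := (Num.conj u.1, u.2^*).
Definition uact u x : A := u.1 *: x + u.2 ⋅ x.
Definition uin x : unitz := (0, x).

Lemma ustarD u v : ustar (u + v) = ustar u + ustar v.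
Proof. by congr pair => /=; rewrite ?rmorphD ?cstarD. Qed.

Lemma ustarN u : ustar (- u) = - ustar u.
Proof. by congr pair => /=; rewrite ?rmorphN ?cstarN. Qed.

Lemma ustarZ (c : R[i]) u : ustar (c *: u) = Num.conj c *: ustar u.
Proof. by congr pair => /=; rewrite ?cstarZ // rmorphM. Qed.

Lemma ustar1 : ustar 1 = 1.
Proof. by congr pair => /=; rewrite ?rmorph1 ?cstar0. Qed.

Lemma uinM x y : uin (x ⋅ y) = uin x * uin y.
Proof. by congr pair; rewrite /= ?mulr0 // !scale0r !add0r. Qed.

Lemma uinD x y : uin (x + y) = uin x + uin y.
Proof. by congr pair; rewrite /= addr0. Qed.

Lemma uinN x : uin (- x) = - uin x.
Proof. by congr pair; rewrite /= oppr0. Qed.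

Lemma uinB x y : uin (x - y) = uin x - uin y.
Proof. by rewrite uinD uinN. Qed.

Lemma uinMn x n : uin (x *+ n) = uin x *+ n.
Proof. by elim: n => [//|n IH]; rewrite !mulrS uinD IH. Qed.

Lemma uinZ (c : R[i]) x : uin (c *: x) = c *: uin x.
Proof. by congr pair; rewrite /= scaler0. Qed.

Lemma ustar_uin x : ustar (uin x) = uin (cstar x).
Proof. by congr pair; rewrite /= rmorph0. Qed.

Lemma uact1 x : uact 1 x = x.
Proof. by rewrite /uact /= scale1r cmul0l addr0. Qed.

Lemma uact_uin x y : uact (uin x) y = x ⋅ y.
Proof. by rewrite /uact /= scale0r add0r. Qed.

Lemma uactM u v x : uact (u * v) x = uact u (uact v x).
Proof.
case: u v => [a y] [b z]; rewrite /uact /= !scalerDr !cmulDl !cmulDr !scalerA.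
by rewrite -!cscaleAl -!cscaleAr !cmulA !addrA.
Qed.

Lemma uactD u v x : uact (u + v) x = uact u x + uact v x.
Proof. by rewrite /uact /= scalerDl cmulDl addrACA. Qed.

Lemma uactN u x : uact (- u) x = - uact u x.
Proof. by rewrite /uact /= scaleNr cmulNl opprD. Qed.

Lemma uactB u v x : uact (u - v) x = uact u x - uact v x.
Proof. by rewrite uactD uactN. Qed.

Lemma uactZ (c : R[i]) u x : uact (c *: u) x = c *: uact u x.
Proof. by rewrite /uact /= scalerDr scalerA cscaleAl. Qed.

Lemma uact_adj u x y : (uact u x)^* ⋅ y = x^* ⋅ uact (ustar u) y.
Proof.
case: u => a z; rewrite /uact /= cstarD cstarZ cstarM cmulDl cmulDr.
by rewrite -cscaleAl -cscaleAr cmulA.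
Qed.

Definition bnd u (M : R) := forall x, nrm (uact u x) <= M * nrm x.

Lemma bndD u v M N : bnd u M -> bnd v N -> bnd (u + v) (M + N).
Proof.
move=> uM vN x; rewrite uactD mulrDl.
by apply: le_trans (nrmD _ _) _; apply: lerD.
Qed.

Lemma bndN u M : bnd u M -> bnd (- u) M.
Proof. by move=> uM x; rewrite uactN nrmN. Qed.

Lemma bndB u v M N : bnd u M -> bnd v N -> bnd (u - v) (M + N).
Proof. by move=> uM /bndN; apply: bndD. Qed.

Lemma bndM u v M N : 0 <= M -> bnd u M -> bnd v N -> bnd (u * v) (M * N).
Proof.
move=> M0 uM vN x; rewrite uactM -mulrA.
by apply: le_trans (uM _) _; apply: ler_wpM2l.
Qed.

Lemma bndZ (r : R) u M : 0 <= r -> bnd u M -> bnd (r%:C *: u) (r * M).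
Proof. by move=> r0 uM x; rewrite uactZ nrmZr // -mulrA ler_wpM2l. Qed.

Lemma bnd1 : bnd 1 1.
Proof. by move=> x; rewrite uact1 mul1r. Qed.

Lemma bndZ1 (r : R) : 0 <= r -> bnd (r%:C *: (1 : unitz)) r.
Proof. by move=> r0; rewrite -[X in bnd _ X]mulr1; apply: bndZ bnd1. Qed.

Lemma bnd_le u M N : M <= N -> bnd u M -> bnd u N.
Proof. by move=> MN uM x; apply: le_trans (uM x) _; apply: ler_wpM2r; rewrite ?nrm_ge0. Qed.

Lemma bnd_uin x M : nrm x <= M -> bnd (uin x) M.
Proof.
move=> xM y; rewrite uact_uin; apply: le_trans (nrmM _ _) _.
by apply: ler_wpM2r; rewrite ?nrm_ge0.
Qed.

(** Testing the bound on the vector [x^*] gives [nrm x ^+ 2 <= M * nrm x] by the C*-identity. *)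
Lemma bnd_uin_le x M : 0 <= M -> bnd (uin x) M -> nrm x <= M.
Proof.
move=> M0 xM; have [->|x0] := eqVneq x 0; first by rewrite nrm0.
rewrite -(ler_pM2r (nrm_gt0 x0)) -expr2 -nrm_mul_cstar -(nrm_star x) -uact_uin.
exact: xM.
Qed.

(** The C*-identity turns [nrm (uact u x) ^+ 2] into the norm of [x^* u^* u x = x^* x]. *)
Lemma bnd_isometry u : ustar u * u = 1 -> bnd u 1.
Proof.
move=> uu x; rewrite mul1r -(ler_pXn2r (n := 2)) ?nnegrE ?nrm_ge0 //.
by rewrite -!nrm_cstarM uact_adj -uactM uu uact1.
Qed.

End Unitization.
Arguments uin {R A}.

(** * Square roots by a monotone iteration *)

Section SquareRootIteration.
Variable R : realType.

(* The iteration [t |-> (x + t^2) / 2] started at [0] converges to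
   [1 - sqrt (1 - x)]; for [x = 1] it dominates the iteration for any [x] of
   size at most [1]. *)
Definition sqrt_it n : R := iter n (fun t => (1 + t ^+ 2) / 2) 0.

Lemma sqrt_itS n : sqrt_it n.+1 = (1 + sqrt_it n ^+ 2) / 2.
Proof. by []. Qed.

Lemma sqrt_it_itv n : 0 <= sqrt_it n <= 1.
Proof. by elim: n => [|n /andP[IH0 IH1]] /=; rewrite ?lexx ?ler01 //; apply/andP; split; nra. Qed.

Lemma sqrt_it_le n : sqrt_it n <= sqrt_it n.+1.
Proof. by rewrite /=; have /andP[? ?] := sqrt_it_itv n; nra. Qed.

Lemma cvg_sqrt_it : sqrt_it n @[n --> \oo] --> (1 : R).
Proof.
have /nondecreasing_is_cvgn bc : nondecreasing_seq sqrt_it.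
  by apply/nondecreasing_seqP => n; apply: sqrt_it_le.
have {bc} bl : sqrt_it n @[n --> \oo] --> limn sqrt_it.
  by apply: bc; exists 1 => _ [n _ <-]; have /andP[] := sqrt_it_itv n.
suff <- : limn sqrt_it = 1 by [].
have bS : sqrt_it n.+1 @[n --> \oo] --> limn sqrt_it by rewrite -(cvg_shiftS sqrt_it) in bl.
have bS' : sqrt_it n.+1 @[n --> \oo] --> (1 + limn sqrt_it * limn sqrt_it) / 2.
  rewrite /=; apply: cvgMr_tmp; apply: cvgD; first exact: cvg_cst.
  exact: cvgM.
(* The fixed-point equation [l = (1 + l^2) / 2] amounts to [(l - 1)^2 = 0]. *)
have h := cvgn_uniq bS bS'.
apply/eqP; rewrite -subr_eq0 -sqrf_eq0; apply/eqP. lra.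
Qed.

Variable A : cstarAlgebra R.
Implicit Types (x y z : A) (u v : unitz A).

Definition usqrt_it u n : unitz A := iter n (fun t => 2^-1 *: (u + t * t)) 0.

Lemma half_real : (2^-1 : R[i]) = (2^-1 : R)%:C.
Proof. by rewrite fmorphV /= rmorph_nat. Qed.

Lemma conj_realC (r : R) : Num.conj (r%:C : R[i]) = r%:C.
Proof. exact: conjc_real. Qed.

Section Iteration.
Variables (b : bool) (y : A).
Hypothesis (y_star : y^* = y) (y_bnd : bnd ((b%:R, y) : unitz A) 1).
(** The scalar part is [0] or [1]: the first case produces cosines from sines, the second square
    roots of positive elements. *)
Let u : unitz A := (b%:R, y).
Let s := usqrt_it u.

Let sS n : s n.+1 = 2^-1 *: (u + s n * s n). Proof. by []. Qed.

Let s_bnd n : bnd (s n) (sqrt_it n).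
Proof.
elim: n => [|n IH]; first by move=> x; rewrite /uact /= scale0r cmul0l addr0 nrm0 mul0r.
rewrite sS half_real /= mulrC; apply: bndZ; first by rewrite invr_ge0.
by apply: bndD => //; rewrite expr2; apply: bndM => //; have /andP[] := sqrt_it_itv n.
Qed.

(** The increment [s n.+2 - s n.+1] is half of [s n.+1 (s n.+1 - s n) + (s n.+1 - s n) s n], whether
    or not the factors commute, and the scalar iteration obeys the same recursion. *)
Let s_diff n : bnd (s n.+1 - s n) (sqrt_it n.+1 - sqrt_it n).
Proof.
elim: n => [|n IH].
  by rewrite !subr0; apply: s_bnd.
have -> : s n.+2 - s n.+1 =
    2^-1 *: (s n.+1 * (s n.+1 - s n) + (s n.+1 - s n) * s n).
  by rewrite mulrBr mulrBl subrKA [s n.+2]sS [in X in _ - X]sS -scalerBr opprD addrACA subrr add0r.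
have -> : sqrt_it n.+2 - sqrt_it n.+1 = 2^-1 * (sqrt_it n.+1 * (sqrt_it n.+1 - sqrt_it n)
  + (sqrt_it n.+1 - sqrt_it n) * sqrt_it n).
  by have := sqrt_itS n; have := sqrt_itS n.+1; lra.
rewrite half_real; apply: bndZ; first by rewrite invr_ge0.
apply: bndD; apply: bndM => //; first by have /andP[] := sqrt_it_itv n.+1.
by rewrite subr_ge0 sqrt_it_le.
Qed.

Let s1 n : (s n).1 = (b%:R * sqrt_it n)%:C.
Proof.
elim: n => [|n IH]; first by rewrite mulr0.
rewrite sS half_real /= IH -[X in X + _](rmorph_nat (real_complex R)) -rmorphM -rmorphD.
rewrite -[LHS]rmorphM; congr (_ %:C).
by case: (b); rewrite ?mulr0n ?mulr1n; field.
Qed.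

(** The component in [A] is the whole increment minus its scalar part; each is bounded by the
    increment of [sqrt_it], hence the factor [2]. *)
Let s2_diff n : nrm ((s n.+1).2 - (s n).2) <= 2 * sqrt_it n.+1 - 2 * sqrt_it n.
Proof.
rewrite -mulrBr mulr_natl mulr2n.
have d0 : 0 <= sqrt_it n.+1 - sqrt_it n by rewrite subr_ge0 sqrt_it_le.
apply: bnd_uin_le; first by rewrite addr_ge0.
have -> : uin ((s n.+1).2 - (s n).2) =
    (s n.+1 - s n) - ((b%:R * (sqrt_it n.+1 - sqrt_it n))%:C *: (1 : unitz A)).
  congr pair; last by rewrite /= scaler0 subr0.
  rewrite [RHS](_ : _ = (s n.+1).1 - (s n).1 -
    (b%:R * (sqrt_it n.+1 - sqrt_it n))%:C * 1) // !s1.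
  by rewrite mulr1 -rmorphB -mulrBr subrr.
apply: bndB => //; apply: bnd_le; last apply: bndZ1.
  by case: (b); rewrite ?mul1r ?mul0r.
by apply: mulr_ge0 => //; apply: ler0n.
Qed.

Let s_cvg : cvgn (fun n => (s n).2).
Proof.
apply: (cvg_dominated (b := fun n => 2 * sqrt_it n) (B := 2)) s2_diff _ => n.
by have /andP[] := sqrt_it_itv n; lra.
Qed.

(** With [t = b + a] the limit equation reads [(1 - t)^2 = 1 - u]: for [b = 0] it is
    [(1 - a)^2 = 1 - y], for [b = 1] it is [a^2 = - y]. Self-adjointness, the bound and commutation
    hold for all iterates and pass to the limit. *)
Lemma sqrt_iteration : exists a : A,
  [/\ a^* = a, a + a = y + b%:R *: (a + a) + a ⋅ a, bnd ((b%:R, a) : unitz A) 1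
    & forall z, z ⋅ y = y ⋅ z -> z ⋅ a = a ⋅ z].
Proof.
pose a := limn (fun n => (s n).2); exists a.
have sa : (s n).2 @[n --> \oo] --> a by exact: s_cvg.
have c1 : ((b%:R * sqrt_it n)%:C : R[i]^o) @[n --> \oo] --> (b%:R : R[i]^o).
  apply/cvg_nrmP => e e0; have /cvgrPdist_lt/(_ _ e0)[N _ bN] := cvg_sqrt_it.
  exists N => n /bN /=; rewrite distrC => bn.
  apply: le_lt_trans bn; rewrite -(rmorph_nat (real_complex R)) -rmorphB.
  rewrite /nrm normc_def /= expr0n /= addr0 sqrtr_sqr.
  by case: (b); rewrite ?mul0r ?subrr ?normr0 // mul1r.
split.
- have st n : (s n).2^* = (s n).2.
    elim: n => [|n IH]; first exact: cstar0.
    rewrite sS /= cstarZ !cstarD y_star !cstarZ cstarM IH s1 half_real.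
    by rewrite !conj_realC.
  have := cvg_cstar sa; under eq_fun do rewrite st.
  by move=> sa'; apply: cvgn_uniq sa' sa.
- have sa1 : (s n.+1).2 + (s n.+1).2 @[n --> \oo] --> a + a.
    by apply: cvgD; rewrite (cvg_shiftS (fun n => (s n).2)).
  have sE n : (s n.+1).2 + (s n.+1).2 =
      y + (b%:R * sqrt_it n)%:C *: ((s n).2 + (s n).2) + (s n).2 ⋅ (s n).2.
    rewrite sS /= -scalerDr -mulr2n -scalerMnr scalerMnl -mulr_natr mulVf ?scale1r ?pnatr_eq0 //.
    by rewrite s1 addrA -scalerDr.
  apply: (cvgn_uniq sa1); under eq_fun do rewrite sE.
  apply: cvgD; last exact: cvg_cmul.
  by apply: cvgD; [exact: cvg_cst|apply: cvgZ => //; apply: cvgD].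
- move=> x.
  have : uact (s n) x @[n --> \oo] --> uact (b%:R, a) x.
    apply: cvgD; last by apply: cvg_cmul => //; exact: cvg_cst.
    by under eq_fun do rewrite s1; apply: cvgZr_tmp.
  move=> /cvg_nrm_le; apply => n; apply: le_trans (s_bnd n x) _.
  by apply: ler_wpM2r; rewrite ?nrm_ge0 //; have /andP[] := sqrt_it_itv n.
- move=> z zy.
  have zs n : z ⋅ (s n).2 = (s n).2 ⋅ z.
    elim: n => [|n IH]; first by rewrite cmul0l cmul0r.
    rewrite sS /= -cscaleAr -cscaleAl !cmulDr !cmulDl zy -!cscaleAr -!cscaleAl.
    by rewrite IH cmulA IH -!cmulA IH.
  have za : z ⋅ (s n).2 @[n --> \oo] --> z ⋅ a by apply: cvg_cmul => //; exact: cvg_cst.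
  apply: (cvgn_uniq za); under eq_fun do rewrite zs.
  by apply: cvg_cmul => //; exact: cvg_cst.
Qed.

End Iteration.
End SquareRootIteration.

(** * Chebyshev bounds from sine-cosine pairs *)

Section SpectralBounds.
Variables (R : realType) (A : cstarAlgebra R).
Implicit Types (x y z g b h k : A) (u v : unitz A).

Lemma nrmMn (V : normedModType R[i]) (x : V) n : nrm (x *+ n) = nrm x *+ n.
Proof.
rewrite -scaler_nat -(rmorph_nat (real_complex R)) nrmZr ?ler0n //.
by rewrite mulr_natl.
Qed.

Lemma bnd_half u (M : R) : bnd (u + u) (M + M) -> bnd u M.
Proof.
move=> uM x; have := uM x; rewrite uactD -mulr2n nrmMn; nra.
Qed.

(* [g = sin t] and [1 - b = cos t] *)
Definition sine_cosine g b : Prop :=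
  [/\ g^* = g, b^* = b, g ⋅ b = b ⋅ g & g ⋅ g = b + b - b ⋅ b].

(** The iteration with scalar part [0] is run on [g^2]; its limit commutes with [g] because [g]
    commutes with [g^2]. *)
Lemma sine_cosine_exists g : g^* = g -> nrm g <= 1 -> exists b, sine_cosine g b.
Proof.
move=> gs g1; have [||b [bs bE _ bC]] := @sqrt_iteration R A false (g ⋅ g).
- by rewrite cstarM gs.
- apply: (@bnd_uin _ _ (g ⋅ g)); rewrite nrm_sq //.
  by rewrite expr_le1 ?nrm_ge0.
exists b; split=> //; first by apply: bC; rewrite cmulA.
by rewrite bE scale0r addr0 addrK.
Qed.

(* With the unitary [u = sin t + i cos t], the three bounds are those of
   [u + u^*], [u^2 + u^*^2] and [u^3 + u^*^3]. *)
Lemma sine_cosine_bounds g b : sine_cosine g b ->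
  [/\ nrm g <= 1, bnd (uin (g ⋅ g) *+ 2 - 1) 1 & nrm ((g ⋅ g ⋅ g) *+ 4 - g *+ 3) <= 1].
Proof.
move=> [gs bs gb gg].
pose G := uin g; pose B := 1 - uin b.
have GB : G * B = B * G by rewrite mulrBr mulrBl mulr1 mul1r -!uinM gb.
(* This is [sin^2 + cos^2 = 1], which makes [u] and [v] below inverse to each other. *)
have GGBB : G * G + B * B = 1.
  rewrite /B mulrBr mulrBl !mulrBl !mul1r mulr1 -!uinM gg uinB uinD.
  by rewrite opprB addrACA addKr addrCA !addrK.
pose u := G + 'i *: B; pose v := G - 'i *: B.
have ii : 'i * 'i = -1 :> R[i] by rewrite -expr2 sqr_i.
have uv : u * v = 1.
  rewrite /u /v mulrDl !mulrBr -!uscaleAl -!uscaleAr GB scalerA ii scaleN1r.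
  by rewrite opprK addrA subrK.
have vu : v * u = 1.
  rewrite /u /v mulrBl !mulrDr -!uscaleAl -!uscaleAr GB scalerA ii scaleN1r.
  by rewrite opprD opprK addrA addrK.
have su : ustar u = v.
  rewrite ustarD ustarZ ustarD ustarN ustar1 !ustar_uin gs bs /v -scaleNr.
  by congr (_ + _ *: _); apply/eqP; rewrite eq_complex /= oppr0 !eqxx.
have sv : ustar v = u.
  rewrite ustarD ustarN ustarZ ustarD ustarN ustar1 !ustar_uin gs bs -scaleNr.
  by congr (_ + _ *: _); apply/eqP; rewrite eq_complex /= oppr0 opprK !eqxx.
have uDv : u + v = G + G by rewrite addrACA subrr addr0.
clearbody u v.
have u1 : bnd u 1 by apply: bnd_isometry; rewrite su.
have v1 : bnd v 1 by apply: bnd_isometry; rewrite sv.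
have uu1 : bnd (u * u) 1 by rewrite -[1]mulr1; apply: bndM.
have vv1 : bnd (v * v) 1 by rewrite -[1]mulr1; apply: bndM.
have uuu1 : bnd (u * u * u) 1 by rewrite -[1]mulr1; apply: bndM.
have vvv1 : bnd (v * v * v) 1 by rewrite -[1]mulr1; apply: bndM.
have uuDvv : u * u + v * v = (G * G *+ 2 - 1) + (G * G *+ 2 - 1).
  have : (u + v) * (u + v) = u * u + v * v + (1 + 1).
    by rewrite mulrDl !mulrDr uv vu -addrA (addrA 1) (addrC (1 + 1)) addrA.
  rewrite uDv mulrDl !mulrDr => /(canLR (addrK _)) <-.
  by rewrite [RHS]addrACA -opprD mulr2n.
split.
- apply: bnd_uin_le => //; apply: bnd_half; rewrite -/G -uDv; exact: bndD.
- by rewrite uinM -/G; apply: bnd_half; rewrite -uuDvv; apply: bndD.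
- apply: bnd_uin_le => //; apply: bnd_half.
  (* Hence [u^3 + v^3 = (u + v) (u^2 + v^2) - (u + v)], which is [2 (4 G^3 - 3 G)]. *)
  have : (u + v) * (u * u + v * v) = (u * u * u + v * v * v) + (u + v).
    rewrite mulrDl !mulrDr !mulrA uv vu !mul1r.
    by rewrite (addrC u (v * v * v)) addrACA (addrC v u).
  rewrite uDv uuDvv => /(canLR (addrK _)) E.
  suff -> : uin (g ⋅ g ⋅ g *+ 4 - g *+ 3) + uin (g ⋅ g ⋅ g *+ 4 - g *+ 3)
      = u * u * u + v * v * v by apply: bndD.
  rewrite -E uinB !uinMn !uinM -/G -!mulr2n mulrnAl mulrnAr -mulrnBl; congr (_ *+ 2).
  rewrite mulrBr mulr1 mulrnAr mulrA mulrnBl -mulrnA.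
  by rewrite -(addrA (_ *+ (2 * 2))) -opprD -mulrSr.
Qed.

End SpectralBounds.

(** * The positive cone and positivity of [x^* x] *)

Section Positivity.
Variables (R : realType) (A : cstarAlgebra R).
Implicit Types (x y z g h k s : A) (u v : unitz A).

(** For self-adjoint [h] the bound places the spectrum in the interval from [0] to [2 M]; in this
    form sums are settled by the triangle inequality. *)
Definition pos h : Prop :=
  h^* = h /\ exists2 M : R, 0 < M & bnd (M%:C *: (1 : unitz A) - uin h) M.

Lemma posD h k : pos h -> pos k -> pos (h + k).
Proof.
move=> [hs [M M0 hM]] [ks [N N0 kN]]; split; first by rewrite cstarD hs ks.
exists (M + N); first exact: addr_gt0.
rewrite rmorphD scalerDl uinD opprD addrACA; exact: bndD.
Qed.

Lemma posZ (r : R) h : 0 < r -> pos h -> pos (r%:C *: h).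
Proof.
move=> r0 [hs [M M0 hM]]; split; first by rewrite cstarZ conj_realC hs.
exists (r * M); first exact: mulr_gt0.
rewrite rmorphM /= -scalerA uinZ -scalerBr; exact: (bndZ (ltW r0)).
Qed.

(** After scaling to norm at most [1], the bound on [C_2] halves to [|1/2 - g^2| <= 1/2]. The
    summand [1] in [m] keeps the division legitimate when [g = 0]. *)
Lemma pos_sq g : g^* = g -> pos (g ⋅ g).
Proof.
move=> gs; pose m := 1 + nrm g.
have m0 : 0 < m by rewrite /m; have := nrm_ge0 g; lra.
pose g1 := (m^-1)%:C *: g.
have gE : g = m%:C *: g1.
  by rewrite scalerA -rmorphM /= divff ?scale1r // gt_eqF.
have g1s : g1^* = g1 by rewrite cstarZ conj_realC gs.
have g11 : nrm g1 <= 1.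
  have mi : 0 <= m^-1 by rewrite invr_ge0 ltW.
  by rewrite nrmZr // ler_pdivrMl // mulr1 /m lerDr.
have [b /sine_cosine_bounds[_ g1b _]] := sine_cosine_exists g1s g11.
clearbody g1; suff : pos (g1 ⋅ g1).
  rewrite gE -cscaleAl -cscaleAr scalerA -rmorphM /= => /(posZ (mulr_gt0 m0 m0)).
  by [].
split; first by rewrite cstarM g1s.
exists (2^-1); first by rewrite invr_gt0.
have hh : 2^-1 + 2^-1 = 1 :> R by lra.
apply: bnd_half; rewrite hh.
have -> : forall w : unitz A, (2^-1 : R)%:C *: (1 : unitz A) - w + ((2^-1 : R)%:C *: (1 : unitz A) - w) = - (w *+ 2 - 1).
  move=> w; rewrite addrACA -scalerDl -rmorphD /= hh scale1r -opprD -mulr2n.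
  by rewrite opprB.
exact: bndN.
Qed.

(** The iteration with scalar part [1] is run on [1 - h / M], of size at most [1]. Its limit [1 + a]
    has [a^2 = h / M], so [s = - sqrt M a] is a root, and [|1 + a| <= 1] puts [s] in the cone with
    constant [sqrt M]. *)
Lemma pos_sqrt h : pos h -> exists s : A,
  [/\ s^* = s, s ⋅ s = h, pos s & forall z, z ⋅ h = h ⋅ z -> z ⋅ s = s ⋅ z].
Proof.
move=> [hs [M M0 hM]]; pose r := Num.sqrt M.
have r0 : 0 < r by rewrite sqrtr_gt0.
have rM : r * r = M by rewrite -expr2 sqr_sqrtr // ltW.
pose y : A := (- M^-1)%:C *: h.
have [||a [as_ aE a1 aC]] := @sqrt_iteration R A true y.
- by rewrite cstarZ conj_realC hs.
- have -> : ((1, y) : unitz A) = (M^-1)%:C *: (M%:C *: (1 : unitz A) - uin h).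
    rewrite scalerBr scalerA -rmorphM /= mulVf ?gt_eqF // scale1r -uinZ.
    by congr pair; rewrite /= ?oppr0 ?addr0 // add0r /y rmorphN scaleNr.
  rewrite -(mulVf (lt0r_neq0 M0)); apply: bndZ hM.
  by rewrite invr_ge0 ltW.
have aa : a ⋅ a = - y.
  move: aE; rewrite scale1r addrAC -[X in X = _]add0r => /addIr /esym.
  by move=> /eqP; rewrite addrC addr_eq0 => /eqP.
exists ((- r)%:C *: a); split.
- by rewrite cstarZ conj_realC as_.
- rewrite -cscaleAl -cscaleAr scalerA -rmorphM mulrNN rM aa /y rmorphN scaleNr opprK.
  by rewrite scalerA -rmorphM divff ?gt_eqF // scale1r.
- split; first by rewrite cstarZ conj_realC as_.
  exists r => //.
  have -> : (r%:C *: (1 : unitz A) - uin ((- r)%:C *: a)) = r%:C *: (1, a) :> unitz A.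
    rewrite uinZ rmorphN scaleNr opprK -scalerDr; congr (_ *: _).
    by congr pair; rewrite /= ?addr0 ?add0r.
  by rewrite -[X in bnd _ X]mulr1; apply: bndZ a1; apply: ltW.
- move=> z zh; rewrite -cscaleAr -cscaleAl aC // /y -cscaleAl -cscaleAr zh.
  by [].
Qed.

(** Up to sign, [c] and [d] are twice the real and imaginary parts of [z], and
    [c^2 + d^2 = 2 (z z^* + z^* z)]. Hence [z z^*] equals [(c^2 + d^2) / 2 + g^2], a combination of
    squares. *)
Lemma pos_mul_cstar z g : g^* = g -> z^* ⋅ z = - (g ⋅ g) -> pos (z ⋅ z^*).
Proof.
move=> gs zz; pose c := z + cstar z; pose d := 'i *: (z - cstar z).
have cs : c^* = c by rewrite cstarD cstarK addrC.
have ds : d^* = d.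
  rewrite cstarZ cstarB cstarK.
  have -> : Num.conj ('i : R[i]) = - 'i.
    by apply/eqP; rewrite eq_complex /= oppr0 !eqxx.
  by rewrite scaleNr -scalerN opprB.
have cd : c ⋅ c + d ⋅ d = (z ⋅ cstar z + cstar z ⋅ z) *+ 2.
  rewrite -cscaleAl -cscaleAr scalerA -expr2 sqr_i scaleN1r.
  rewrite !cmulDl !cmulDr !cmulNl !cmulNr !opprD !opprK.
  rewrite addrACA (addrC (z ⋅ z) (z ⋅ cstar z)) (addrC (- (z ⋅ z))) (addrACA (z ⋅ cstar z)) subrr addr0.
  by rewrite [X in _ + X]addrACA subrr addr0 addrACA mulr2n.
have : pos (c ⋅ c + d ⋅ d + g ⋅ g + g ⋅ g) 
  by apply: posD; [apply: posD; [apply: posD|]|]; apply: pos_sq.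
rewrite cd -addrA -mulr2n -mulrnDl zz subrK => /(@posZ 2^-1).
have hh : 2^-1 + 2^-1 = 1 :> R by lra.
rewrite mulr2n scalerDr -scalerDl -rmorphD /= hh scale1r.
by apply; rewrite invr_gt0.
Qed.

(** As [z z^*] is positive of norm at most [1], so [1 - z z^*] is a contraction. This bounds
    [z - z z^* z = z + z g^2] and in turn [g + g^3], against the bound on [C_3] at [g]. *)
Lemma cstarM_neg_sq_nrm1 z g :
  nrm z = 1 -> g^* = g -> z^* ⋅ z = - (g ⋅ g) -> False.
Proof.
move=> z1 gs zz.
have g1 : nrm g = 1.
  apply: (@pexpIrn _ 2); rewrite ?nnegrE ?nrm_ge0 //.
  by rewrite -nrm_sq // -nrmN -zz nrm_cstarM z1.
have [k [ks kk _ _]] := pos_sqrt (pos_mul_cstar gs zz).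
have k1 : nrm k <= 1.
  rewrite -(@expr_le1 _ 2) ?nrm_ge0 // -nrm_sq // kk nrm_mul_cstar z1.
  by rewrite expr1n.
have [b /sine_cosine_bounds[_ kb _]] := sine_cosine_exists ks k1.
have kb' : bnd (1 - uin (k ⋅ k)) 1.
  apply: bnd_half.
  have -> : 1 - uin (k ⋅ k) + (1 - uin (k ⋅ k)) = 1 - (uin (k ⋅ k) *+ 2 - 1).
    by rewrite opprB addrACA -opprD -addrA (mulr2n (uin _)).
  apply: bndB kb; exact: bnd1.
have := kb' z; rewrite uactB uact1 uact_uin kk mul1r z1 -cmulA zz cmulNr opprK.
set z' := z + _ => z'1.
pose w := g + g ⋅ g ⋅ g.
have ws : w^* = w by rewrite cstarD !cstarM gs cmulA.
(* Here [z' = z (1 + g^2)], so the left side is [- (1 + g^2) g^2 (1 + g^2)]. *)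
have z'z' : z'^* ⋅ z' = - (w ⋅ w).
  have zzx x : cstar z ⋅ (z ⋅ x) = - (g ⋅ (g ⋅ x)) by rewrite !cmulA zz cmulNl.
  rewrite /z' /w cstarD !cstarM gs !cmulDl !cmulDr -!cmulA !zzx zz.
  by rewrite !cmulNr -!opprD.
have w1 : nrm w <= 1.
  rewrite -(@expr_le1 _ 2) ?nrm_ge0 // -nrm_sq // -nrmN -z'z' nrm_cstarM.
  by rewrite expr_le1 ?nrm_ge0.
have [|b' /sine_cosine_bounds[_ _ g3]] := @sine_cosine_exists _ _ g gs; first by rewrite g1.
(* Since [4 (g + g^3) - (4 g^3 - 3 g) = 7 g] and [|g| = 1], this leads to the absurd
   [7 <= 4 + 1]. *)
have : nrm (g *+ 7) <= nrm (w *+ 4) + nrm (g ⋅ g ⋅ g *+ 4 - g *+ 3).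
  apply: le_trans (nrmB _ _); rewrite /w mulrnDl opprB addrACA.
  by rewrite subrr addr0 -mulrnDr.
rewrite !nrmMn g1; lra.
Qed.

Lemma cstarM_neg_sq z g : g^* = g -> z^* ⋅ z = - (g ⋅ g) -> z = 0.
Proof.
move=> gs zz; apply/eqP/negPn/negP => z0.
have r0 := nrm_gt0 z0.
pose r : R := (nrm z)^-1; have rge : 0 <= r by rewrite invr_ge0 ltW.
apply: (@cstarM_neg_sq_nrm1 (r%:C *: z) (r%:C *: g)).
- by rewrite nrmZr // mulVf // gt_eqF.
- by rewrite cstarZ conj_realC gs.
- rewrite cstarZ conj_realC -!cscaleAl -!cscaleAr zz.
  by rewrite !scalerN.
Qed.

(** Let [s] be the root of [h^2], that is [|h|], and [q = s - h], twice the negative part of [h].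
    From [h q = - s q] and [t^2 = s] follows [(x q)^* (x q) = - (t q)^2], so [x q = 0] by
    [cstarM_neg_sq]. Then [s q = h q = 0], hence [q^2 = 0] and [h = s]. *)
Lemma cstarM_pos x : pos (x^* ⋅ x).
Proof.
pose h := x^* ⋅ x.
have hs : h^* = h by rewrite cstarM cstarK.
have [s [ss sE spos sC]] := pos_sqrt (pos_sq hs).
have sh : h ⋅ s = s ⋅ h by apply: sC; rewrite cmulA.
have [t [ts tE _ tC]] := pos_sqrt spos.
have th : h ⋅ t = t ⋅ h by apply: tC.
have st : s ⋅ t = t ⋅ s by apply: tC.
pose q := s - h.
have qs : q^* = q by rewrite cstarB ss hs.
have tq : t ⋅ q = q ⋅ t by rewrite cmulBr cmulBl th st.
have hq : h ⋅ q = - (s ⋅ q) by rewrite !cmulBr sh sE opprB.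
have qE : q = s - h by [].
clearbody q; have xq : x ⋅ q = 0.
  apply: (@cstarM_neg_sq _ (t ⋅ q)); first by rewrite cstarM ts qs.
  rewrite cstarM qs cmulA -(cmulA q _ x) -/h -cmulA hq cmulNr; congr (- _).
  by rewrite -tE {1}tq -!cmulA.
have sq : s ⋅ q = 0.
  by apply: oppr_inj; rewrite -hq /h -cmulA xq cmul0r oppr0.
have q0 : q = 0.
  by apply: cstarM_eq0; rewrite qs {1}qE cmulBl hq sq oppr0 subrr.
have -> : x^* ⋅ x = s by apply/esym/eqP; rewrite -subr_eq0 -/h -qE q0.
exact: spos.
Qed.

End Positivity.

(** * Contractivity and closed range of *-homomorphisms *)

Section StarHom.
Variables (R : realType) (A B : cstarAlgebra R) (f : A -> B).
Hypothesis fhom : is_star_hom f.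
Implicit Types (x y h k g b : A).

Lemma star_homD x y : f (x + y) = f x + f y.
Proof. by rewrite -[x]scale1r (star_homP fhom) !scale1r. Qed.

Lemma star_hom0 : f 0 = 0.
Proof. by apply: (addrI (f 0)); rewrite -star_homD !addr0. Qed.

Lemma star_homZ (c : R[i]) x : f (c *: x) = c *: f x.
Proof. by rewrite -[_ *: x]addr0 (star_homP fhom) star_hom0 addr0. Qed.

Lemma star_homN x : f (- x) = - f x.
Proof. by rewrite -scaleN1r star_homZ scaleN1r. Qed.

Lemma star_homB x y : f (x - y) = f x - f y.
Proof. by rewrite star_homD star_homN. Qed.

Lemma star_homMn x n : f (x *+ n) = f x *+ n.
Proof. by elim: n => [|n IH]; rewrite ?star_hom0 // !mulrS star_homD IH. Qed.

(** [sine_cosine] consists of algebraic identities, so [f] carries such a pair to another one, whose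
    first entry has norm at most [1]. *)
Lemma nrm_star_hom_sa h : h^* = h -> nrm (f h) <= nrm h.
Proof.
move=> hs; have [->|h0] := eqVneq h 0; first by rewrite star_hom0 !nrm0.
have r0 := nrm_gt0 h0.
pose r : R := (nrm h)^-1; have rge : 0 <= r by rewrite invr_ge0 ltW.
have [||b [gs bs gb gg]] := @sine_cosine_exists _ _ (r%:C *: h).
- by rewrite cstarZ conj_realC hs.
- by rewrite nrmZr // mulVf // gt_eqF.
have /sine_cosine_bounds[] : sine_cosine (f (r%:C *: h)) (f b).
  split; rewrite -?(star_hom_star fhom) -?(star_homM fhom) ?gs ?bs ?gb ?gg //.
  by rewrite star_homB star_homD.
by rewrite star_homZ nrmZr // /r ler_pdivrMl // mulr1.
Qed.

Lemma nrm_star_hom x : nrm (f x) <= nrm x.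
Proof.
rewrite -(@ler_pXn2r _ 2) ?nnegrE ?nrm_ge0 // -!nrm_cstarM.
rewrite -(star_hom_star fhom) -(star_homM fhom).
by apply: nrm_star_hom_sa; rewrite cstarM cstarK.
Qed.

Lemma cvg_star_hom (u : nat -> A) l :
  u n @[n --> \oo] --> l -> f (u n) @[n --> \oo] --> f l.
Proof.
move=> /cvg_nrmP ul; apply/cvg_nrmP => e /ul[N uN]; exists N => n /uN.
by rewrite -star_homB; apply: le_lt_trans (nrm_star_hom _).
Qed.

(* [k = - M C_3 (h / M) / 3] for the Chebyshev polynomial [C_3 = 4 X^3 - 3 X]:
   it has a third of the norm allowed for [h], and it agrees with [h] up to
   terms of order three. *)
Lemma chebyshev_shrink h (M : R) : 0 < M -> h^* = h -> nrm h <= M ->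
  exists k, [/\ k^* = k, nrm k <= M / 3 &
    nrm (f h - f k) <= 4 / 3 * nrm (f h) ^+ 3 / M ^+ 2].
Proof.
move=> M0 hs hM; pose g := (M^-1)%:C *: h.
have Mi : 0 <= M^-1 by rewrite invr_ge0 ltW.
have gs : g^* = g by rewrite cstarZ conj_realC hs.
have g1 : nrm g <= 1 by rewrite nrmZr // ler_pdivrMl // mulr1.
have [b /sine_cosine_bounds[_ _ g3]] := sine_cosine_exists gs g1.
have hE : h = M%:C *: g by rewrite scalerA -rmorphM /= divff ?scale1r // gt_eqF.
have fg : nrm (f g) = M^-1 * nrm (f h) by rewrite star_homZ nrmZr.
clearbody g.
exists (- (M / 3)%:C *: (g ⋅ g ⋅ g *+ 4 - g *+ 3)); split.
- rewrite cstarZ rmorphN /= conj_realC; congr (_ *: _).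
  by rewrite cstarB !cstarMn !cstarM gs cmulA.
- rewrite scaleNr nrmN nrmZr; last by rewrite divr_ge0 // ltW.
  by rewrite ler_piMr // divr_ge0 // ltW.
- rewrite hE -star_homB.
  (* The linear terms cancel, so only the cubic term of [C_3] contributes to the error. *)
  have -> : M%:C *: g - - (M / 3)%:C *: (g ⋅ g ⋅ g *+ 4 - g *+ 3) =
      (M / 3)%:C *: (g ⋅ g ⋅ g *+ 4).
    rewrite scaleNr opprK scalerBr addrCA -[RHS]addr0; congr (_ + _).
    rewrite -scaler_nat scalerA -(rmorph_nat (real_complex R)) -rmorphM /=.
    by rewrite -mulrA mulVf ?mulr1 ?subrr // pnatr_eq0.
  rewrite star_homZ star_homMn !(star_homM fhom).
  rewrite nrmZr; last by rewrite divr_ge0 // ltW.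
  rewrite nrmMn -hE.
  have : nrm (f g ⋅ f g ⋅ f g) <= nrm (f g) ^+ 3.
    rewrite exprSr expr2; apply: le_trans (nrmM _ _) _.
    by rewrite ler_wpM2r ?nrm_ge0 // nrmM.
  rewrite fg => le3.
  have -> : 4 / 3 * nrm (f h) ^+ 3 / M ^+ 2 = M / 3 * ((M^-1 * nrm (f h)) ^+ 3 *+ 4).
    by rewrite -mulr_natr; field; rewrite gt_eqF.
  apply: ler_wpM2l; first by rewrite divr_ge0 // ltW.
  by rewrite lerMn2r le3 orbT.
Qed.

(** Each round divides the allowed norm of the lift by [3] and costs an error of at most
    [2 / 3 * 9^-1 ^+ n.+1]. The slack [4^-1 * 9^-1 ^+ n] in both bounds on the image absorbs these
    errors as a geometric series. *)
Lemma lift_sa_unit n h : h^* = h -> nrm h <= 2 * 3 ^+ n ->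
  nrm (f h) <= 1 + 4^-1 * 9^-1 ^+ n ->
  exists k, [/\ k^* = k, nrm k <= 2 & nrm (f h - f k) <= 4^-1 - 4^-1 * 9^-1 ^+ n].
Proof.
elim: n h => [|n IH] h hs hM fh.
  by exists h; rewrite subrr nrm0 expr0 mulr1 subrr; split=> //; lra.
have M0 : 0 < 2 * 3 ^+ n.+1 :> R by rewrite mulr_gt0 // exprn_gt0.
have [k [ks kM hk]] := chebyshev_shrink M0 hs hM.
pose q : R := 9^-1 ^+ n.+1.
have q0 : 0 < q by rewrite exprn_gt0 // invr_gt0.
have q1 : q <= 1 by rewrite exprn_ile1 // ?invr_ge0 // invf_le1 // ler1n.
have qn : 9^-1 ^+ n = 9 * q by rewrite /q exprS mulrA divff ?mul1r ?pnatr_eq0.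
have Mq : ((2 * 3 ^+ n.+1) ^+ 2)^-1 = q / 4 :> R.
  rewrite exprMn -exprM mulnC exprM invfM mulrC /q exprVn.
  by rewrite -!(natrX R _ 2).
have {}hk : nrm (f h - f k) <= 2 / 3 * q.
  apply: le_trans hk _; rewrite Mq; move: fh; rewrite -/q => fh.
  have := nrm_ge0 (f h); move: (nrm (f h)) fh => r rq r0.
  (* The slack is at most [1 / 4], and [(5 / 4)^3 < 2]. *)
  have r3 : r ^+ 3 <= (5 / 4) ^+ 3 by rewrite lerXn2r ?nnegrE //; lra.
  have -> : 4 / 3 * r ^+ 3 * (q / 4) = q * (r ^+ 3 / 3) by field.
  rewrite mulrC ler_wpM2r // ?ltW //; move: r3; rewrite exprS; lra.
have kM' : nrm k <= 2 * 3 ^+ n.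
  apply: le_trans kM _; rewrite exprS; lra.
have fk : nrm (f k) <= 1 + 4^-1 * 9^-1 ^+ n.
  have : nrm (f k) <= nrm (f h) + nrm (f h - f k).
    by rewrite -{1}(subKr (f h) (f k)) nrmB.
  rewrite qn; move: fh hk; rewrite -/q; lra.
have [k' [k's k'2 kk']] := IH k ks kM' fk.
exists k'; split=> //.
rewrite -(subrKA (f k)) -/q; apply: le_trans (nrmD _ _) _.
move: kk' hk; rewrite qn; lra.
Qed.

Lemma lift_sa h (r : R) : 0 < r -> h^* = h -> nrm (f h) <= r ->
  exists k, nrm k <= 2 * r /\ nrm (f h - f k) <= r / 4.
Proof.
move=> r0 hs fh; have ri : 0 <= r^-1 by rewrite invr_ge0 ltW.
pose g := (r^-1)%:C *: h.
have hE : h = r%:C *: g by rewrite scalerA -rmorphM /= divff ?scale1r // gt_eqF.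
have gs : g^* = g by rewrite cstarZ conj_realC hs.
have fg : nrm (f g) <= 1 by rewrite star_homZ nrmZr // ler_pdivrMl // mulr1.
clearbody g; pose n := Num.truncn (nrm g).
have p9 m : 0 <= 4^-1 * 9^-1 ^+ m :> R.
  by apply: mulr_ge0; [|apply: exprn_ge0]; rewrite invr_ge0.
have [||k [_ k2 gk]] := @lift_sa_unit n.+1 g gs.
- have := truncnS_gt (nrm g); rewrite -/n => gn.
  have : (n.+1%:R <= 3 ^+ n.+1 :> R) by rewrite -natrX ler_nat ltnW // ltn_expl.
  have := nrm_ge0 g; lra.
- apply: le_trans fg _; by rewrite lerDl p9.
exists (r%:C *: k); split; first by rewrite (nrmZr _ (ltW r0)) mulrC ler_wpM2r // ltW.
rewrite hE !star_homZ -scalerBr nrmZr; last exact: ltW.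
apply: ler_wpM2l; first exact: ltW.
by apply: le_trans gk _; rewrite gerBl p9.
Qed.

(** The Cartesian decomposition [x = h + i g] reduces this to self-adjoint elements and doubles both
    constants. *)
Lemma lift_approx x (r : R) : 0 < r -> nrm (f x) <= r ->
  exists k, nrm k <= 4 * r /\ nrm (f x - f k) <= r / 2.
Proof.
move=> r0 fx.
pose h := (2^-1)%:C *: (x + cstar x); pose g := (2^-1)%:C *: ('i *: (cstar x - x)).
have i_conj : Num.conj ('i : R[i]) = - 'i.
  by apply/eqP; rewrite eq_complex /= oppr0 !eqxx.
have hh : 2^-1 + 2^-1 = 1 :> R by lra.
have xE : x = h + 'i *: g.
  rewrite /g scalerA mulrC -scalerA (scalerA 'i 'i) -expr2 sqr_i scaleN1r opprB -scalerDr.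
  by rewrite addrACA subrr addr0 scalerDr -scalerDl -rmorphD /= hh scale1r.
have hs : h^* = h by rewrite cstarZ conj_realC cstarD cstarK addrC.
have gs : g^* = g.
  by rewrite cstarZ conj_realC cstarZ i_conj cstarB cstarK scaleNr -scalerN opprB.
have half0 : 0 <= 2^-1 :> R by rewrite invr_ge0.
have fxs : nrm (f (cstar x)) <= r by rewrite (star_hom_star fhom) nrm_star.
have fh : nrm (f h) <= r.
  rewrite star_homZ nrmZr // star_homD.
  have := nrmD (f x) (f (cstar x)); lra.
have fg : nrm (f g) <= r.
  rewrite !star_homZ nrmZr // nrmZi star_homB.
  have := nrmB (f (cstar x)) (f x); lra.
have [k [k2 hk]] := lift_sa r0 hs fh; have [l [l2 gl]] := lift_sa r0 gs fg.
exists (k + 'i *: l); split.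
  by have := nrmD k ('i *: l); rewrite nrmZi; lra.
rewrite xE -star_homB opprD addrACA -scalerBr star_homD star_homZ !star_homB.
have := nrmD (f h - f k) ('i *: (f g - f l)); rewrite nrmZi; lra.
Qed.

Lemma closed_range_star_hom : closed (range f).
Proof.
apply: closed_nrmP => y yf.
pose r : R := 1 + nrm y.
have r0 : 0 < r by rewrite /r; have := nrm_ge0 y; lra.
pose q n : R := (3 / 4) ^+ n * r.
have q0 n : 0 < q n by rewrite mulr_gt0 // exprn_gt0.
have qS n : q n.+1 = 3 / 4 * q n by rewrite /q exprS mulrA.
(* To correct a lift [s] with error at most [q n], some [f x] is taken within [q n / 8] of [y] and
   [x - s] is replaced by a short [k]. The new error is at most [9/16 + 1/8 < 3/4] of [q n]. Where
   [s] is no such lift, [F] takes the dummy value [0]. *)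
have /choice[F FP] (p : nat * A) : exists k, nrm (y - f p.2) <= q p.1 ->
    nrm (y - f k) <= q p.1.+1 /\ nrm (k - p.2) <= 8 * q p.1.
  case: p => n s /=; have [ys|] := pselect (nrm (y - f s) <= q n); last by exists 0.
  have [|_ [x _ <-] yx] := yf (q n / 8); first by rewrite divr_gt0.
  have xs : nrm (f (x - s)) <= 9 / 8 * q n.
    have -> : f (x - s) = (y - f s) - (y - f x).
      by rewrite star_homB opprB [RHS]addrC subrKA.
    by have := nrmB (y - f s) (y - f x); lra.
  have [|k [k4 xk]] := lift_approx _ xs; first by rewrite mulr_gt0.
  exists (s + k) => _; rewrite qS; split; last first.
    by rewrite addrAC subrr add0r; have := q0 n; lra.
  have -> : y - f (s + k) = (y - f x) + (f (x - s) - f k).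
    by rewrite star_homB star_homD opprD !addrA subrK.
  by have := nrmD (y - f x) (f (x - s) - f k); have := q0 n; lra.
pose S := fix S n := if n is m.+1 then F (m, S m) else 0.
have SP n : nrm (y - f (S n)) <= q n.
  elim: n => [|n IH]; last by have [] := FP (n, S n) IH.
  by rewrite /= star_hom0 subr0 /q expr0 mul1r /r; lra.
have Sc : cvgn S.
  (* As [q n - q n.+1 = q n / 4], steps of size [8 * q n] telescope against [- 32 * q n]. *)
  apply: (@cvg_dominated _ _ S (fun n => - 32 * q n) 0) => n.
    have [_] := FP (n, S n) (SP n); rewrite qS /=; have := q0 n; lra.
  by have := q0 n; lra.
exists (limn S) => //; apply: cvgn_uniq (cvg_star_hom Sc) _.
have : q n @[n --> \oo] --> 0 * r.
  by apply: cvgMr_tmp; apply: cvg_expr; rewrite ger0_norm; lra.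
rewrite mul0r => /cvgrPdist_lt qc; apply/cvg_nrmP => e /qc[N _ qN]; exists N => n /qN /=.
by rewrite sub0r normrN gtr0_norm // nrm_distC; apply: le_lt_trans (SP n).
Qed.

End StarHom.

(** * Closed linear spans, their products and adjoints *)

Section Spans.
Variable R : realType.

Section Closure.
Variable V : normedModType R[i].
Implicit Types (S M : set V).

Lemma is_submoduleZ S (c : R[i]) x : is_submodule S -> S x -> S (c *: x).
Proof. by move=> hS Sx; rewrite -[_ *: _]addr0; apply: submoduleP => //; apply: submodule0. Qed.

Lemma is_submodule_sum S n (v : 'I_n -> V) :
  is_submodule S -> (forall i, S (v i)) -> S (\sum_(i < n) v i).
Proof.
move=> hS Sv; elim/big_ind: _ => //; first exact: submodule0.
by move=> x y Sx Sy; rewrite -[x]scale1r; apply: submoduleP.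
Qed.

Lemma lin_span_submodule S : is_submodule (lin_span S).
Proof.
split.
  by exists 0%N, (fun=> 0), (fun=> 0); split; [case|rewrite big_ord0].
move=> c _ _ [n [a [v [Sv ->]]]] [m [b [w [Sw ->]]]].
exists (n + m)%N, (fun i : 'I_(n + m) => match fintype.split i with inl j => c * a j | inr j => b j end),
  (fun i : 'I_(n + m) => match fintype.split i with inl j => v j | inr j => w j end); split.
  by move=> i; case: fintype.split.
rewrite big_split_ord scaler_sumr; congr (_ + _); apply: eq_bigr => i _.
  by rewrite (unsplitK (inl i)) scalerA.
by rewrite (unsplitK (inr i)).
Qed.

Lemma closure_submodule S : is_submodule S -> is_submodule (closure S).
Proof.
move=> hS; split; first by apply: subset_closure; apply: submodule0.
move=> c x y /closure_nrmP Sx /closure_nrmP Sy; apply/closure_nrmP => e e0.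
pose K := complex.Re `|c|.
have K0 : 0 <= K by rewrite /K normc_def /= sqrtr_ge0.
have [|x' Sx' xx'] := Sx (e / (2 * (1 + K))); first by rewrite divr_gt0 // mulr_gt0 //; lra.
have [|y' Sy' yy'] := Sy (e / 2); first by rewrite divr_gt0.
exists (c *: x' + y'); first exact: submoduleP.
rewrite opprD addrACA -scalerBr; apply: le_lt_trans (nrmD _ _) _.
rewrite nrmZ -/K.
have : K * nrm (x - x') <= e / 2.
  apply: (@le_trans _ _ ((1 + K) * (e / (2 * (1 + K))))).
    by apply: ler_pM; rewrite ?nrm_ge0 //; [lra|exact: ltW].
  by rewrite le_eqVlt; apply/orP; left; apply/eqP; field; lra.
lra.
Qed.

Lemma closed_span_submodule S : is_submodule (closed_span S).
Proof. exact: closure_submodule (lin_span_submodule S). Qed.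

Lemma closed_span_closed S : closed (closed_span S).
Proof. exact: closed_closure. Qed.

Lemma sub_closed_span S : S `<=` closed_span S.
Proof.
move=> x Sx; apply: subset_closure; exists 1%N, (fun=> 1), (fun=> x).
by rewrite big_ord1 scale1r.
Qed.

Lemma closed_span_min S M : is_submodule M -> closed M -> S `<=` M -> closed_span S `<=` M.
Proof.
move=> hM cM SM; rewrite (closure_id M).1 //; apply: closureS.
move=> _ [n [c [v [Sv ->]]]]; apply: is_submodule_sum => // i.
by apply: is_submoduleZ => //; apply: SM.
Qed.

End Closure.

Lemma closed_preimage_bounded (V W : normedModType R[i]) (f : V -> W) (K : R) (N : set W) :
  (forall x y, nrm (f x - f y) <= K * nrm (x - y)) -> closed N -> closed (f @^-1` N).
Proof.
move=> fK cN; apply: closed_nrmP => x xN /=.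
apply: cN; apply/closure_nrmP => e e0.
have K0 : 0 < 1 + `|K| by have := normr_ge0 K; lra.
have [|y Ny xy] := xN (e / (1 + `|K|)); first by rewrite divr_gt0.
exists (f y) => //; apply: le_lt_trans (fK _ _) _.
rewrite ltr_pdivlMr // in xy; apply: le_lt_trans xy.
rewrite mulrC ler_wpM2l ?nrm_ge0 //; have := ler_norm K; lra.
Qed.

Variable A : cstarAlgebra R.
Implicit Types (S N : set A).

(** One factor is extended at a time: first the right one next to a generator [z], then the left one
    next to an arbitrary [y] of the closed span. *)
Lemma closed_span_cmul S S' N : is_submodule N -> closed N ->
  (forall x y, S x -> S' y -> N (x ⋅ y)) ->
  forall x y, closed_span S x -> closed_span S' y -> N (x ⋅ y).
Proof.
move=> hN cN SN x y Sx Sy.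
have Sx' z : S z -> N (z ⋅ y).
  move=> Sz; apply: (@closed_span_min _ S' [set y | N (z ⋅ y)]) => //.
  - split=> /= [|c u v Nu Nv]; first by rewrite cmul0r; apply: submodule0.
    by rewrite cmulDr -cscaleAr; apply: submoduleP.
  - apply: (@closed_preimage_bounded _ _ (cmul z) (nrm z)) => // u v.
    by rewrite -cmulBr nrmM.
  - by move=> u; apply: SN.
apply: (@closed_span_min _ S [set x | N (x ⋅ y)]) => //.
- split=> /= [|c u v Nu Nv]; first by rewrite cmul0l; apply: submodule0.
  by rewrite cmulDl -cscaleAl; apply: submoduleP.
- apply: (@closed_preimage_bounded _ _ (cmul^~ y) (nrm y)) => // u v.
  by rewrite -cmulBl mulrC nrmM.
Qed.

Lemma closed_span_cstar S N : is_submodule N -> closed N ->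
  (forall x, S x -> N (cstar x)) -> forall x, closed_span S x -> N (cstar x).
Proof.
move=> hN cN SN; apply: (@closed_span_min _ S [set x | N (cstar x)]) => //.
- split=> /= [|c u v Nu Nv]; first by rewrite cstar0; apply: submodule0.
  by rewrite cstarD cstarZ; apply: submoduleP.
- apply: (@closed_preimage_bounded _ _ (@cstar R A) 1) => // u v.
  by rewrite -cstarB nrm_star mul1r.
Qed.

End Spans.

(** * Products of generators and their adjoints *)

Section GraphRelationsTheory.
Variables (R : realType) (L : ordinalGraph) (B : cstarAlgebra R) (T : L -> B).
Hypothesis rT : graph_relations T.
Implicit Types (e f g h : L).

Lemma gen_src_star e : (T (src e))^* = T (src e).
Proof. by rewrite -(graph_rel_src rT) cstarM cstarK. Qed.

Lemma gen_mul_src e : T e ⋅ T (src e) = T e.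
Proof.
have h : src e = rng (src e) by rewrite rng_src.
by rewrite (graph_rel_comp rT h) compose_src.
Qed.

Lemma gen_rng_mul e : T (rng e) ⋅ T e = T e.
Proof.
have h : src (rng e) = rng e by rewrite src_rng.
by rewrite (graph_rel_comp rT h) compose_rng.
Qed.

Lemma gen_partial_isometry e : T e ⋅ (T e)^* ⋅ T e = T e.
Proof. by rewrite -cmulA (graph_rel_src rT) gen_mul_src. Qed.

(** Distinct vertices do not extend one another, so the projections at [src e] and [rng f], inserted
    between the factors, are orthogonal. *)
Lemma gen_mul0 e f : src e <> rng f -> T e ⋅ T f = 0.
Proof.
move=> ef; rewrite -(gen_mul_src e) -(gen_rng_mul f) -cmulA (cmulA _ _ (T f)).
have vv g : T (src g) ⋅ (T (src g))^* = T (src g).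
  by rewrite gen_src_star -{2}(src_src g) gen_mul_src.
rewrite -(src_rng f) -vv -(vv (rng f)) (graph_rel_orth rT) ?cmul0l ?cmul0r //.
- rewrite src_rng => -[g [fg eE]]; apply: ef.
  by rewrite -(rng_src e) eE rng_comp rng_rng.
- rewrite src_rng => -[g [fg fE]]; apply: ef.
  by rewrite -(rng_rng f) fE rng_comp rng_src.
Qed.

Lemma gen_mul e f : T e ⋅ T f = 0 \/
  exists2 p, deg p = (deg e + deg f)%ord & T e ⋅ T f = T p.
Proof.
have [ef|/gen_mul0] := pselect (src e = rng f); last by left.
by right; exists (compose ef); rewrite ?deg_comp // (graph_rel_comp rT).
Qed.

(** If one path extends the other, the common part cancels and the remainder [p] is left. Otherwise
    the inserted range projections of [f] and [g] are orthogonal. *)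
Lemma gen_star_mul f g : [\/ (T f)^* ⋅ T g = 0,
  exists2 p, deg g = (deg f + deg p)%ord & (T f)^* ⋅ T g = T p |
  exists2 p, deg f = (deg g + deg p)%ord & (T f)^* ⋅ T g = (T p)^*].
Proof.
have ext f' g' : extends f' g' ->
    exists2 p, deg g' = (deg f' + deg p)%ord & (T f')^* ⋅ T g' = T p.
  move=> [p [fp ->]]; exists p; first by rewrite deg_comp.
  by rewrite -(graph_rel_comp rT fp) cmulA (graph_rel_src rT) fp gen_rng_mul.
have [/ext|nfg] := pselect (extends f g); first by constructor 2.
have [/ext[p gp Tp]|ngf] := pselect (extends g f).
  by constructor 3; exists p => //; rewrite -Tp cstarM cstarK.
constructor 1; rewrite -(gen_partial_isometry f) -(gen_partial_isometry g).
rewrite !cstarM cstarK -!cmulA (cmulA (T f)) (cmulA (T f ⋅ _)) (cmulA (T f ⋅ _ ⋅ _)).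
rewrite -(cmulA (T f ⋅ _)) (graph_rel_orth rT) // ?cmul0l ?cmul0r //.
Qed.

(** All products of spanning elements are computed by this rule; the degree equations decide in
    which span the result lies. *)
Lemma gen_cmul4 e f g h :
  [\/ T e ⋅ (T f)^* ⋅ (T g ⋅ (T h)^*) = 0,
   exists p q : L, [/\ deg g = (deg f + deg p)%ord, deg q = (deg e + deg p)%ord &
      T e ⋅ (T f)^* ⋅ (T g ⋅ (T h)^*) = T q ⋅ (T h)^*] |
   exists p q : L, [/\ deg f = (deg g + deg p)%ord, deg q = (deg h + deg p)%ord &
      T e ⋅ (T f)^* ⋅ (T g ⋅ (T h)^*) = T e ⋅ (T q)^*]].
Proof.
have -> : T e ⋅ (T f)^* ⋅ (T g ⋅ (T h)^*) = T e ⋅ ((T f)^* ⋅ T g) ⋅ (T h)^*.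
  by rewrite !cmulA.
have [->|[p gp ->]|[p fp ->]] := gen_star_mul f g.
- by constructor 1; rewrite cmul0r cmul0l.
- have [->|[q qp ->]] := gen_mul e p; first by constructor 1; rewrite cmul0l.
  by constructor 2; exists p, q.
- rewrite -cmulA -cstarM.
  have [->|[q qp ->]] := gen_mul h p; first by constructor 1; rewrite cstar0 cmul0r.
  by constructor 3; exists p, q.
Qed.

End GraphRelationsTheory.

(** * The universal algebra as a closed span of products of generators *)

Section GraphAlgebraSpan.
Variables (R : realType) (L : ordinalGraph) (B : cstarAlgebra R) (T : L -> B).
Hypothesis hB : is_graph_algebra T.

Let gens : set B := [set x | exists e f, x = T e ⋅ (T f)^*].
Let D := closed_span gens.

Let subD : is_cstar_subalgebra D.
Proof.
have hD : is_submodule D by exact: closed_span_submodule.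
have cD : closed D by exact: closed_span_closed.
split=> // [x y|x].
- apply: closed_span_cmul => // _ _ [e [f ->]] [g [h ->]].
  have [->|[p [q [_ _ ->]]]|[p [q [_ _ ->]]]] := gen_cmul4 hB.1 e f g h.
  + exact: submodule0.
  + by apply: sub_closed_span; exists q, h.
  + by apply: sub_closed_span; exists e, q.
- apply: closed_span_cstar => // _ [e [f ->]].
  by rewrite cstarM cstarK; apply: sub_closed_span; exists f, e.
Qed.

Let T_D e : D (T e).
Proof.
apply: sub_closed_span; exists e, (src e).
by rewrite (gen_src_star hB.1) (gen_mul_src hB.1).
Qed.

Let S e : subalgebra_type subD := subalgebra_mk subD (@T_D e).

Let rS : graph_relations S.
Proof.
have rT := hB.1; split.
- by move=> e; apply: val_inj; apply: (graph_rel_src rT).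
- by move=> e f ef; apply: val_inj; apply: (graph_rel_comp rT).
- by move=> e f ef; apply: val_inj; apply: (graph_rel_extl rT).
- by move=> e f ef; apply: val_inj; apply: (graph_rel_extr rT).
- by move=> e f ef fe; apply: val_inj; apply: (graph_rel_orth rT).
- move=> v F vv Ffin Fex; have [[vs vi] vu vl] := graph_rel_join rT vv Ffin Fex.
  split.
  + by split; apply: val_inj.
  + by move=> _ [e Fe <-]; apply: val_inj; apply: vu; exists e.
  (* A projection of the subalgebra is one of [B], so the join in [B] remains least among fewer
     candidates. *)
  + move=> q [qs qi] qu; apply: val_inj; apply: vl.
      by split; [apply: (congr1 val qs)|apply: (congr1 val qi)].
    by move=> _ [e Fe <-]; apply: (congr1 val (qu _ (ex_intro2 _ _ e Fe erefl))).
Qed.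

(* Both the identity and the map provided by the universal property towards the
   closed span are *-homomorphisms fixing the generators. *)
Lemma graph_algebra_span x : D x.
Proof.
have [pi [[pihom piT] _]] := hB.2 _ _ rS.
have [id' [_ id'u]] := hB.2 _ _ hB.1.
have e1 : id' = id by apply: id'u.
have e2 : id' = val \o pi.
  apply: id'u; split; last by move=> e; rewrite /= piT.
  split=> *; rewrite /=.
  - by rewrite (star_homP pihom).
  - by rewrite (star_homM pihom).
  - by rewrite (star_hom_star pihom).
have <- : val (pi x) = x by rewrite -[LHS]/((val \o pi) x) -e2 e1.
exact: subalgebra_valP.
Qed.

End GraphAlgebraSpan.

(** * Ordinal arithmetic around [ω^ a] *)

Section OrdinalArithmetic.
Variable a : Ord.
Local Notation w := (ω^ a)%ord.
Implicit Types d g p : Ord.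

Lemma Ord_muln2 (b : Ord) : (b * 2 = b + b)%ord.
Proof. by rewrite /Ord_muln /= Ord_add0. Qed.

Lemma Ord_wpow_itv_split d : (w <= d)%O -> (d < (w * 2)%ord)%O ->
  exists2 c, (c < w)%O & d = (w + c)%ord.
Proof.
by move=> wd; rewrite Ord_muln2 => /Ord_lt_add[|//]; rewrite ltNge wd.
Qed.

(** Additive indecomposability: [w < g + w] would give [w = g + c] with [c < w], but sums of
    ordinals below [w] stay below [w]. *)
Lemma Ord_wpow_absorb g : (g < w)%O -> (g + w)%ord = w.
Proof.
move=> gw; apply/le_anti; rewrite Ord_le_addl andbT leNgt; apply/negP.
move=> /Ord_lt_add[wg|[c cw wE]]; first by rewrite ltNge (ltW gw) in wg.
by have := Ord_wpow_add_lt gw cw; rewrite -wE ltxx.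
Qed.

(** This serves [X A] in [X]: with [d = w + c], the tail [c + p] is still below [w]. *)
Lemma Ord_itv_addr d p : (w <= d)%O -> (d < (w * 2)%ord)%O -> (p < w)%O ->
  (w <= (d + p)%ord)%O /\ ((d + p)%ord < (w * 2)%ord)%O.
Proof.
move=> wd dw pw; split; first exact: le_trans wd (Ord_le_addr _ _).
have [c cw ->] := Ord_wpow_itv_split wd dw.
rewrite Ord_muln2 -Ord_addA; apply/Ord_lt_add; right.
by exists (c + p)%ord => //; apply: Ord_wpow_add_lt.
Qed.

(** This serves [A X] in [X], where a short initial piece [d] is exchanged for a short [g]. As [d]
    is short, [p = w + c], and [w] absorbs [g]. *)
Lemma Ord_itv_shift d g p : (w <= (d + p)%ord)%O -> ((d + p)%ord < (w * 2)%ord)%O ->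
  (d < w)%O -> (g < w)%O -> (w <= (g + p)%ord)%O /\ ((g + p)%ord < (w * 2)%ord)%O.
Proof.
move=> wdp dpw dw gw.
have wp : (w <= p)%O.
  by rewrite leNgt; apply/negP => /(Ord_wpow_add_lt dw); rewrite ltNge wdp.
split; first exact: le_trans wp (Ord_le_addl _ _).
have [c cw ->] := Ord_wpow_itv_split wp (le_lt_trans (Ord_le_addl _ _) dpw).
rewrite Ord_addA Ord_wpow_absorb // Ord_muln2; apply/Ord_lt_add; right.
by exists c.
Qed.

(** This serves [X^* X] in [A]: if [p] too were at least [w], the sum would reach [w + w]. *)
Lemma Ord_itv_sub d p : (w <= d)%O -> ((d + p)%ord < (w * 2)%ord)%O -> (p < w)%O.
Proof.
rewrite Ord_muln2 => wd dpw; rewrite ltNge; apply/negP => wp.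
move: dpw; rewrite ltNge => /negP; apply.
move: (w) wd wp => v; elim/Ord_ind: d => x; elim/Ord_ind: p => y; elim/Ord_ind: v => v.
by rewrite -!Defs.pi_add => /pi_leP vx /pi_leP vy; apply/pi_leP; apply: tree_add_le.
Qed.

End OrdinalArithmetic.

(** * Closed subspaces of a C*-algebra as correspondences *)

Section HilbertModule.
Variables (R : realType) (B : cstarAlgebra R) (A X : set B).
Hypotheses (hA : is_cstar_subalgebra A) (hX : is_submodule X) (cX : closed X).
Hypothesis XA : forall x b, X x -> A b -> X (x ⋅ b).
Hypothesis AX : forall b x, A b -> X x -> X (b ⋅ x).
Hypothesis XX : forall x y, X x -> X y -> A (x^* ⋅ y).

Let submodule_valP (x : submodule_type hX) : X (val x).
Proof. by have /asboolP := valP x. Qed.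

Let mkX x (Xx : X x) : submodule_type hX := exist _ x (asboolT Xx).

(** The bound over [B] restricts to the vectors of the subalgebra, so the square root is formed
    inside the subalgebra itself. *)
Lemma subalgebra_positive (x : subalgebra_type hA) : pos (val x) -> positive x.
Proof.
move=> [xs [M M0 xM]].
have /pos_sqrt[s [ss <- _ _]] : pos x.
  split; first exact: val_inj.
  by exists M => // z; apply: (xM (val z)).
by exists s; rewrite ss.
Qed.

Lemma cstar_subspace_correspondence :
  exists (act : submodule_type hX -> subalgebra_type hA -> submodule_type hX)
    (inner : submodule_type hX -> submodule_type hX -> subalgebra_type hA)
    (phi : subalgebra_type hA -> submodule_type hX -> submodule_type hX),
    [/\ forall x b, val (act x b) = val x ⋅ val b,
        forall b x, val (phi b x) = val b ⋅ val x,
        forall x y, val (inner x y) = (val x)^* ⋅ val y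
      & is_correspondence act inner phi].
Proof.
pose act x b := mkX (XA (submodule_valP x) (subalgebra_valP (hS := hA) b)).
pose phi b x := mkX (AX (subalgebra_valP (hS := hA) b) (submodule_valP x)).
pose inner x y := subalgebra_mk hA (XX (submodule_valP x) (submodule_valP y)).
(* By the C*-identity the module norm is the norm of [B], so completeness comes from that of [B] and
   closedness of [X]. *)
have norm_inner x : module_norm inner x = (nrm (val x))%:C.
  have -> : module_norm inner x = sqrtC `|cstar (val x) ⋅ val x| by [].
  by rewrite cnorm_star sqrCK // normE.
exists act, inner, phi; split=> //; split; first split.
- by move=> x y b; apply: val_inj; apply: cmulDl.
- by move=> x b c; apply: val_inj; apply: cmulDr.
- by move=> c x b; apply: val_inj; rewrite /= cscaleAl.
- by move=> c x b; apply: val_inj; rewrite /= cscaleAr.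
- by move=> x b c; apply: val_inj; apply: cmulA.
- by move=> c x y z; apply: val_inj; rewrite /= cmulDr cscaleAr.
- by move=> x y b; apply: val_inj; apply: cmulA.
- by move=> x y; apply: val_inj; rewrite /= cstarM cstarK.
- by move=> x; apply: subalgebra_positive; apply: cstarM_pos.
- move=> x /(congr1 val)/= x0; apply: val_inj; exact: cstarM_eq0.
- move=> u uc.
  have /cvg_ex[/= l ul] : cvgn (fun n => val (u n) : B).
    apply: nrm_complete => e e0.
    have [|N uN] := uc e%:C; first by rewrite ltcR.
    by exists N => m n Nm Nn; have := uN m n Nm Nn; rewrite norm_inner ltcR.
  have Xl : X l.
    apply: (@closed_cvg _ _ \oo _ (fun n => val (u n) : B) X cX _ l ul).
    by apply: nearW => n; apply: submodule_valP.
  exists (mkX Xl) => e e0.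
  have eR : (complex.Re e)%:C = e by rewrite RRe_real // gtr0_real.
  move/cvg_nrmP: ul => /(_ (complex.Re e))[|N uN]; first by rewrite -ltcR eR.
  by exists N => n Nn; rewrite norm_inner -eR ltcR; apply: uN.
- move=> b; exists (phi (cstar b)) => x y; apply: val_inj.
  by rewrite /= cstarM cmulA.
- by move=> c b b' x; apply: val_inj; rewrite /= cmulDl cscaleAl.
- by move=> b b' x; apply: val_inj; rewrite /= cmulA.
- by move=> b x y; apply: val_inj; rewrite /= cstarM cmulA.
Qed.

End HilbertModule.

(** * The correspondence of an ordinal graph *)

Lemma range_star_hom_subalgebra (R : realType) (A B : cstarAlgebra R) (f : A -> B) :
  is_star_hom f -> is_cstar_subalgebra (range f).
Proof.
move=> fhom; split.
- split; first by exists 0 => //; rewrite (star_hom0 fhom).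
  by move=> c _ _ [x _ <-] [y _ <-]; exists (c *: x + y); rewrite ?(star_homP fhom).
- by move=> _ _ [x _ <-] [y _ <-]; exists (x ⋅ y); rewrite ?(star_homM fhom).
- by move=> _ [x _ <-]; exists (cstar x); rewrite ?(star_hom_star fhom).
- exact: closed_range_star_hom.
Qed.

Theorem theorem6p1 (R : realType) (L : ordinalGraph) (a : Ord)
  (* O(L_a) and O(L_(a+1)) with their generators *)
  (O0 : cstarAlgebra R) (T0 : subgraph L a -> O0) (hO0 : is_graph_algebra T0)
  (O1 : cstarAlgebra R) (T : subgraph L (a + 1)%ord -> O1) (hO1 : is_graph_algebra T)
  (* the *-homomorphism O(L_a) -> O(L_(a+1)) *)
  (rho : O0 -> O1) (rho_hom : is_star_hom rho)
  (rhoT : forall e : subgraph L a, rho (T0 e) = T (sub_incl (Ord_le_addr a 1%ord) e)) :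
  let A : set O1 := range rho in
  let X : set O1 := closed_span
    [set x | exists (e : subgraph L (a + 1)%ord) (f : subgraph L a),
       [/\ ((ω^ a)%ord <= deg e)%O,
           (deg e < (ω^ a * 2)%ord)%O
         & x = T e ⋅ (T (sub_incl (Ord_le_addr a 1%ord) f))^*]] in
  exists (hA : is_cstar_subalgebra A) (hX : is_submodule X)
    (act : submodule_type hX -> subalgebra_type hA -> submodule_type hX)
    (inner : submodule_type hX -> submodule_type hX -> subalgebra_type hA)
    (phi : subalgebra_type hA -> submodule_type hX -> submodule_type hX),
    [/\ forall x b, val (act x b) = val x ⋅ val b,
        forall b x, val (phi b x) = val b ⋅ val x,
        forall x y, val (inner x y) = (val x)^* ⋅ val y
      & is_correspondence act inner phi].
Proof.
move=> A X; have rT := hO1.1.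
pose inc := @sub_incl L _ _ (Ord_le_addr a 1%ord).
have incP (e : subgraph L (a + 1)%ord) : (deg e < (ω^ a)%ord)%O ->
    exists f, T e = T (inc f).
  move=> elt; exists (@sub_mk L a (val (e : Defs.sub_path L (a + 1)%ord)) elt).
  by congr T; apply: val_inj.
have inc_lt f : (deg (inc f) < (ω^ a)%ord)%O by exact: valP f.
have hA : is_cstar_subalgebra A by exact: range_star_hom_subalgebra.
have hX : is_submodule X by exact: closed_span_submodule.
have cX : closed X by exact: closed_span_closed.
have cA : closed A by exact: subalgebra_closed hA.
have sA : is_submodule A by exact: subalgebra_submodule hA.
have genX e f : ((ω^ a)%ord <= deg e)%O -> (deg e < (ω^ a * 2)%ord)%O ->
    (deg f < (ω^ a)%ord)%O -> X (T e ⋅ (T f)^*).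
  move=> we ew /incP[f' ->]; apply: sub_closed_span; exists e, f'; split=> //.
have genA g h : (deg g < (ω^ a)%ord)%O -> (deg h < (ω^ a)%ord)%O ->
    A (T g ⋅ (T h)^*).
  move=> /incP[g' ->] /incP[h' ->]; exists (T0 g' ⋅ (T0 h')^*) => //.
  by rewrite (star_homM rho_hom) (star_hom_star rho_hom) !rhoT.
pose G : set O1 := [set x | exists g h, [/\ (deg g < (ω^ a)%ord)%O,
  (deg h < (ω^ a)%ord)%O & x = T g ⋅ (T h)^*]].
(* The preimage of the closed span of [G] under the contractive [rho] is a closed submodule
   containing the products that span [O0]. *)
have AG : A `<=` closed_span G.
  move=> _ [x _ <-]; have := @graph_algebra_span _ _ _ _ hO0 x.
  apply: (@closed_span_min _ _ _ [set x | closed_span G (rho x)]).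
  - have hG := closed_span_submodule G.
    split=> /= [|c y z Gy Gz]; first by rewrite (star_hom0 rho_hom); apply: (submodule0 hG).
    by rewrite (star_homP rho_hom); apply: (submoduleP hG).
  - apply: (@closed_preimage_bounded _ _ _ rho 1); last exact: closed_span_closed.
    by move=> y z; rewrite -(star_homB rho_hom) mul1r (nrm_star_hom rho_hom).
  - move=> _ [e [f ->]] /=; apply: sub_closed_span; exists (inc e), (inc f).
    by rewrite (star_homM rho_hom) (star_hom_star rho_hom) !rhoT.
exists hA, hX; apply: cstar_subspace_correspondence => //.
- move=> x b Xx /AG Ab; apply: (closed_span_cmul hX cX _ Xx Ab).
  move=> _ _ [e [f [we ew ->]]] [g [h [ga ha ->]]].
  have fa := inc_lt f.
  have [->|[p [q [gE qE ->]]]|[p [q [fE qE ->]]]] := gen_cmul4 rT e (inc f) g h.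
  + exact: submodule0.
  (* [p] is what remains of the short path [g], so appending it to [e] keeps the degree in the
     interval. *)
  + have pa : (deg p < (ω^ a)%ord)%O.
      by apply: le_lt_trans ga; rewrite gE Ord_le_addl.
    by have [wq qw] := Ord_itv_addr we ew pa; apply: genX; rewrite ?qE.
  + apply: genX => //; rewrite qE; apply: Ord_wpow_add_lt => //.
    by apply: le_lt_trans fa; rewrite fE Ord_le_addl.
- move=> b x /AG Ab Xx; apply: (closed_span_cmul hX cX _ Ab Xx).
  move=> _ _ [g [h [ga ha ->]]] [e [f [we ew ->]]].
  have fa := inc_lt f.
  have [->|[p [q [eE qE ->]]]|[p [q [hE qE ->]]]] := gen_cmul4 rT g h e (inc f).
  + exact: submodule0.
  + rewrite eE in we ew; have [wq qw] := Ord_itv_shift we ew ha ga.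
    by apply: genX; rewrite ?qE.
  (* Here the short [h] would have at least the degree of [e], a contradiction. *)
  + by have := Ord_le_addr (deg e) (deg p); rewrite -hE leNgt (lt_le_trans ha we).
- move=> x y Xx Xy.
  (* Adjoints of elements of [X] lie in a closed span as well, so [closed_span_cmul] covers
     [X^* X]. *)
  pose X' : set O1 := [set x | exists e f, [/\ ((ω^ a)%ord <= deg e)%O,
    (deg e < (ω^ a * 2)%ord)%O, (deg f < (ω^ a)%ord)%O & x = T f ⋅ (T e)^*]].
  have Xs : closed_span X' (cstar x).
    move: Xx; apply: closed_span_cstar => [||_ [e [f [we ew ->]]]].
    + exact: closed_span_submodule.
    + exact: closed_span_closed.
    + apply: sub_closed_span; exists e, (inc f); split=> //.
      by rewrite cstarM cstarK.
  apply: (closed_span_cmul sA cA _ Xs Xy).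
  move=> _ _ [e [f [we ew fa ->]]] [g [h [wg gw ->]]].
  have ha := inc_lt h.
  have [->|[p [q [gE qE ->]]]|[p [q [eE qE ->]]]] := gen_cmul4 rT f e g (inc h).
  + exact: submodule0.
  (* Both [e] and [g] have degree in the interval, so the remainder [p] is short, whichever of the
     two extends the other. *)
  + rewrite gE in gw; have pa := Ord_itv_sub we gw.
    by apply: genA; rewrite ?qE //; apply: Ord_wpow_add_lt.
  + rewrite eE in ew; have pa := Ord_itv_sub wg ew.
    by apply: genA; rewrite ?qE //; apply: Ord_wpow_add_lt.
Qed.
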